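(* Let $n\ge3$ be an odd integer and let $\overline U$ be a symmetric $n$-wedge. Then $\overline U$ may be tiled by two congruent tiles.
   Context: Tile: if $\gamma$ is a simple closed plane curve bounding an open contractible region $U$, the closure $\overline U=U\cup\gamma$ is called a tile, with boundary $\gamma$. Two tiles are congruent if one is the image of the other under an isometry of the plane, possibly orientation reversing. A closed bounded set is tiled by a set of tiles if it is their union and distinct tiles meet only along their boundaries. Rotation: for an angle $\alpha$ and a point $p$, $\alpha_p$ denotes the anticlockwise rotation of the plane by $\alpha$ about $p$. Radial generation: let $\eta$ be a continuous planar curve segment with no self-intersections, $p$ a point on $\eta$, and $\alpha\in(0,2\pi)$. The union of $\eta$, $\eta'=\alpha_p(\eta)$ and the circular arcs centred at $p$ connecting the end-points of $\eta$ with the corresponding end-points of $\eta'$ is a contour $\gamma=[\eta,p,\alpha]$. It is the boundary of a tile if and only if it is simple; in that case the tile $\overline U$ is said to be radially generated by $\eta$, $p$ and $\alpha$, written $\overline U=\langle\eta,p,\alpha\rangle$. (In this case $p$ is an end-point of $\eta$ and exactly one arc is added.) Wedge: a tile is generated by a point $p$ if it equals $\langle\eta,p,\alpha\rangle$ for some $\eta,\alpha$. A wedge is a tile that is radially generated by exactly two points (vertices of its boundary). For an odd integer $n\ge3$, an $n$-wedge is a wedge of the form $\langle\eta,p,\pi/n\rangle=\langle\nu,q,\pi/n\rangle$ with $p\ne q$. A wedge is symmetric if it has a line of symmetry. *)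

(* Defs.v *)
From mathcomp Require Import all_boot all_order all_algebra.
From mathcomp Require Import all_classical all_reals all_analysis.

Set Implicit Arguments.
Unset Strict Implicit.
Unset Printing Implicit Defensive.

Import Order.TTheory GRing.Theory Num.Theory.
Import numFieldNormedType.Exports.

Local Open Scope classical_set_scope.
Local Open Scope ring_scope.

(* The product topology and the sup norm of R * R give the Euclidean topology
   and the Euclidean bounded sets; isometries refer to [edist], not to the
   sup norm. *)
Notation plane R := (R * R)%type.

Definition edist (R : realType) (x y : plane R) : R :=
  Num.sqrt ((x.1 - y.1) ^+ 2 + (x.2 - y.2) ^+ 2).

(* Orientation-reversing isometries are included. *)
Definition plane_isometry (R : realType) (f : plane R -> plane R) : Prop :=
  forall x y, edist (f x) (f y) = edist x y.

Definition congruent (R : realType) (A B : set (plane R)) : Prop :=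
  exists2 f : plane R -> plane R, plane_isometry f & f @` A = B.

Definition rotation (R : realType) (a : R) (p x : plane R) : plane R :=
  (p.1 + cos a * (x.1 - p.1) - sin a * (x.2 - p.2),
   p.2 + sin a * (x.1 - p.1) + cos a * (x.2 - p.2)).

(* Reflection in the line through [a] with direction [u], meant for u != 0. *)
Definition reflection (R : realType) (a u x : plane R) : plane R :=
  let t := ((x.1 - a.1) * u.1 + (x.2 - a.2) * u.2) / (u.1 ^+ 2 + u.2 ^+ 2) in
  (a.1 + (2 * t * u.1 - (x.1 - a.1)), a.2 + (2 * t * u.2 - (x.2 - a.2))).

Definition has_symmetry_line (R : realType) (A : set (plane R)) : Prop :=
  exists a u : plane R, u != 0 /\ reflection a u @` A = A.

(* A parametrised curve segment without self-intersections; only the values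
   on [0, 1] matter. *)
Definition curve_segment (R : realType) (e : R -> plane R) : Prop :=
  {within `[0, 1], continuous e} /\ set_inj `[0, 1] e.

Definition simple_closed_curve (R : realType) (g : set (plane R)) : Prop :=
  exists f : R -> plane R,
    [/\ {within `[0, 1], continuous f}, f 0 = f 1, set_inj `[0, 1[ f &
        f @` `[0, 1] = g].

Definition contractible (R : realType) (U : set (plane R)) : Prop :=
  exists x0 : plane R, U x0 /\
  exists H : R -> plane R -> plane R,
    [/\ {within `[0, 1] `*` U, continuous (fun z : R * (R * R) => H z.1 z.2)},
        forall t x, 0 <= t <= 1 -> U x -> U (H t x),
        forall x, U x -> H 0 x = x &
        forall x, U x -> H 1 x = x0].

(* Boundedness is automatic once U is contractible, since the exterior of a
   simple closed curve is not. *)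
Definition curve_bounds (R : realType) (g U : set (plane R)) : Prop :=
  [/\ open U, bounded_set U & closure U `\` U = g].

Definition tile_with_boundary (R : realType) (T g : set (plane R)) : Prop :=
  simple_closed_curve g /\
  exists U : set (plane R),
    [/\ curve_bounds g U, contractible U & T = U `|` g].

Definition tile (R : realType) (T : set (plane R)) : Prop :=
  exists g : set (plane R), tile_with_boundary T g.

(* By the Jordan curve theorem a tile has only one boundary curve, so that the
   quantification over g1 and g2 just names the two boundaries. *)
Definition tiled_by (R : realType) (X : set (plane R))
    (F : set (set (plane R))) : Prop :=
  [/\ closed X /\ bounded_set X,
      forall T, F T -> tile T,
      \bigcup_(T in F) T = X &
      forall T1 T2, F T1 -> F T2 -> T1 <> T2 ->
        forall g1 g2, tile_with_boundary T1 g1 -> tile_with_boundary T2 g2 ->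
          T1 `&` T2 `<=` g1 `&` g2].

(* The arc swept by x under the anticlockwise rotations about p through the
   angles between 0 and a; it is {p} if x = p. *)
Definition swept_arc (R : realType) (a : R) (p x : plane R) : set (plane R) :=
  [set rotation t p x | t in `[0, a]].

Definition contour (R : realType) (e : R -> plane R) (p : plane R) (a : R) :
    set (plane R) :=
  e @` `[0, 1] `|` rotation a p @` (e @` `[0, 1]) `|`
  swept_arc a p (e 0) `|` swept_arc a p (e 1).

Definition radially_generated (R : realType) (T : set (plane R))
    (e : R -> plane R) (p : plane R) (a : R) : Prop :=
  [/\ curve_segment e, (e @` `[0, 1]) p, 0 < a < 2 * pi &
      tile_with_boundary T (contour e p a)].

Definition generated_by_point (R : realType) (T : set (plane R)) (p : plane R) :
    Prop :=
  exists (e : R -> plane R) (a : R), radially_generated T e p a.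

Definition wedge_tile (R : realType) (T : set (plane R)) : Prop :=
  tile T /\
  exists p q : plane R,
    p <> q /\ forall x, generated_by_point T x <-> x = p \/ x = q.

Definition n_wedge (R : realType) (n : nat) (T : set (plane R)) : Prop :=
  wedge_tile T /\
  exists (e f : R -> plane R) (p q : plane R),
    [/\ p <> q, radially_generated T e p (pi / n%:R) &
        radially_generated T f q (pi / n%:R)].

(* Main.v *)
(* A tile with a line of symmetry is cut along that line. Write the tile as
   [U `|` g]. The reflection preserves [g] and [U] because no point of [g] is
   interior to the tile: otherwise the frontier of the tile would lie on an arc,
   a retract of the plane; retracting the tile onto it and fixing the outside
   would miss [U], while a map of the plane that is the identity far away
   is onto. The reflection then acts on the loop [g] as a decreasing involution
   of its parameter, so [g] meets the line in exactly two points; the open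
   segment between them is the trace of [U] on the line, and together with one
   half of [g] it bounds a half of [U]. That half is contractible: compose the
   contraction of [U] with the folding along the line, and push the result off
   the line by an amount less than the distance to the complement of [U]. *)
Require Import Defs.
From mathcomp Require Import all_boot all_order all_algebra.
From mathcomp Require Import all_classical all_reals all_analysis.
From mathcomp Require Import ring lra.

Set Implicit Arguments.
Unset Strict Implicit.
Unset Printing Implicit Defensive.

Import Order.TTheory GRing.Theory Num.Theory.
Import numFieldNormedType.Exports.

Local Open Scope classical_set_scope.
Local Open Scope ring_scope.

(** * Oriented angles between nearby vectors, and their sums *)

Definition dotp (R : realType) (a b : plane R) : R := a.1 * b.1 + a.2 * b.2.

Definition crossp (R : realType) (a b : plane R) : R :=
  a.1 * b.2 - a.2 * b.1.

(** The angle from [a] to [b] is at most pi/4 in absolute value. Three such angles stay short of a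
    half turn, so they add without a correction by multiples of 2 pi. *)
Definition small_turn (R : realType) (a b : plane R) : Prop :=
  0 < dotp a b /\ `|crossp a b| <= dotp a b.

(** The oriented angle from [a] to [b] when [dotp a b] is positive, the range where the arctangent
    gives it directly. *)
Definition turn (R : realType) (a b : plane R) : R :=
  atan (crossp a b / dotp a b).

Lemma sin_eq0_small (R : realType) (x : R) : `|x| < pi -> sin x = 0 -> x = 0.
Proof.
rewrite ltr_norml => /andP[x1 x2] sx.
case: (ltgtP x 0) => // hx; last first.
  by have := @sin_gt0_pi _ x; rewrite hx x2 sx ltxx => /(_ isT).
have := @sin_gt0_pi _ (- x); rewrite oppr_gt0 hx ltrNl x1 sinN sx oppr0 ltxx.
by move=> /(_ isT).
Qed.

Lemma turn_le (R : realType) (a b : plane R) :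
  small_turn a b -> `|turn a b| <= pi / 4.
Proof.
move=> [d0 cd]; rewrite /turn -atan1 ler_norml.
move: cd; rewrite ler_norml => /andP[c1 c2].
by rewrite -atanN !le_atan// ?ler_pdivlMr ?ler_pdivrMr// ?mul1r// mulN1r.
Qed.

(** The defect is at most 3 pi/4 in absolute value and its sine vanishes. *)
Lemma turnD (R : realType) (a b c : plane R) :
  small_turn a b -> small_turn b c -> small_turn a c ->
  turn a b + turn b c = turn a c.
Proof.
move=> ab bc ac; apply/eqP; rewrite -subr_eq0; apply/eqP.
apply: sin_eq0_small.
  have := turn_le ab; have := turn_le bc; have := turn_le ac.
  have := pi_gt0 R.
  rewrite !ler_norml ltr_norml => p0 /andP[? ?] /andP[? ?] /andP[? ?].
  by apply/andP; split; lra.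
have sinE (x : R) : sin (atan x) = x * cos (atan x).
  rewrite -[X in X * _]atanK /tan mulfVK//.
  by rewrite cos_atan invr_eq0 gt_eqF// sqrtr_gt0 ltr_pwDl ?sqr_ge0.
rewrite sinB sinD cosD /turn !sinE.
case: ab bc ac => [d1 _] [d2 _] [d3 _].
set t1 := crossp a b / _; set t2 := crossp b c / _; set t3 := crossp a c / _.
transitivity ((t1 + t2 - t3 + t1 * t2 * t3) *
  (cos (atan t1) * cos (atan t2) * cos (atan t3))); first by ring.
(* [dotp a b] and [crossp a b] are the real and imaginary parts of conj(a) b, and (conj(a)
   b)(conj(b) c) = |b|^2 conj(a) c. This is the addition law for the tangents. *)
suff -> : t1 + t2 - t3 + t1 * t2 * t3 = 0 by rewrite mul0r.
have := lt0r_neq0 d1; have := lt0r_neq0 d2; have := lt0r_neq0 d3.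
rewrite /t1 /t2 /t3 /crossp /dotp => z3 z2 z1.
by field; rewrite z1 z2 z3.
Qed.

Lemma prod_norm_le (R : realType) (x : plane R) (e : R) :
  `|x| <= e <-> `|x.1| <= e /\ `|x.2| <= e.
Proof.
rewrite prod_normE ge_max; split; first by move/andP.
by move=> [-> ->].
Qed.

Lemma prod_norm_lt (R : realType) (x : plane R) (e : R) :
  `|x| < e <-> `|x.1| < e /\ `|x.2| < e.
Proof.
rewrite prod_normE gt_max; split; first by move/andP.
by move=> [-> ->].
Qed.

(** With m the norm of [a], a product of a coordinate of [a] and one of [a - b] is at most m^2/4 in
    absolute value. Hence [dotp a b] is at least m^2/2 and [crossp a b] at most m^2/2 in absolute
    value. *)
Lemma small_turn_close (R : realType) (a b : plane R) :
  0 < `|a| -> 4 * `|a - b| <= `|a| -> small_turn a b.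
Proof.
move=> a0 ab; set m := `|a| in a0 ab.
have [h1 h2] : `|(a - b).1| <= m / 4 /\ `|(a - b).2| <= m / 4.
  by apply/prod_norm_le; lra.
have [h3 h4] : `|a.1| <= m /\ `|a.2| <= m by apply/prod_norm_le.
have hm : m = `|a.1| \/ m = `|a.2|.
  by rewrite /m prod_normE /Num.max; case: ifP; [right|left].
have a2 : a.1 ^+ 2 + a.2 ^+ 2 >= m ^+ 2.
  by case: hm => ->; rewrite -normrX ger0_norm ?sqr_ge0// ?lerDl ?lerDr sqr_ge0.
case: a b {ab hm a0} @m h1 h2 h3 h4 a2 (a0) => [a1 a2] [b1 b2] m /=.
rewrite !ler_norml => /andP[p1 p2] /andP[p3 p4] /andP[p5 p6] /andP[p7 p8] q m0.
have bnd (x y : R) : - m <= x <= m -> - (m / 4) <= y <= m / 4 ->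
    - (m ^+ 2 / 4) <= x * y <= m ^+ 2 / 4.
  move=> /andP[x1 x2] /andP[y1 y2].
  rewrite -ler_norml normrM (_ : m ^+ 2 / 4 = m * (m / 4)); last by field.
  by apply: ler_pM => //; rewrite ler_norml ?x1 ?y1.
have /andP[u1 v1] := bnd a1 (a1 - b1) ltac:(by apply/andP) ltac:(by apply/andP).
have /andP[u2 v2] := bnd a2 (a2 - b2) ltac:(by apply/andP) ltac:(by apply/andP).
have /andP[u3 v3] := bnd a1 (a2 - b2) ltac:(by apply/andP) ltac:(by apply/andP).
have /andP[u4 v4] := bnd a2 (a1 - b1) ltac:(by apply/andP) ltac:(by apply/andP).
have m2 : 0 < m ^+ 2 by rewrite exprn_gt0.
rewrite /small_turn /dotp /crossp /= ler_norml; split; first by lra.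
by apply/andP; split; lra.
Qed.

(** The diagonal cuts each cell of the grid into two triangles, and angles add on both. The change
    from one row to the next therefore telescopes, and it cancels because the first and last columns
    agree. *)
Lemma turn_sum_homotopy (R : realType) (N : nat) (c : nat -> nat -> plane R) :
  (forall i, c i N = c i 0) ->
  (forall i j (d e : bool), (i + d <= N)%N -> (j + e <= N)%N ->
    small_turn (c i j) (c (i + d)%N (j + e)%N)) ->
  \sum_(j < N) turn (c 0 j) (c 0 j.+1) = \sum_(j < N) turn (c N j) (c N j.+1).
Proof.
move=> cN cs.
suff H i : (i <= N)%N -> \sum_(j < N) turn (c 0 j) (c 0 j.+1) =
    \sum_(j < N) turn (c i j) (c i j.+1) by exact: H.
elim: i => [//|i IH] iN; rewrite IH; last exact: ltnW.
apply/eqP; rewrite -subr_eq0 -sumrB.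
rewrite (eq_bigr (fun j : 'I_N => - (turn (c i j.+1) (c i.+1 j.+1) -
  turn (c i j) (c i.+1 j)))) => [|j _].
  rewrite sumrN -(big_mkord xpredT (fun j => turn (c i j.+1) (c i.+1 j.+1) -
    turn (c i j) (c i.+1 j))) telescope_sumr// !cN subrr oppr0 //.
have jN := ltn_ord j.
have := cs i j false true; have := cs i j true false; have := cs i j true true.
have := cs i j.+1 true false; have := cs i.+1 j false true.
rewrite !addn0 !addn1 => /(_ iN jN) s1 /(_ iN jN) s2 /(_ iN jN) s3.
move=> /(_ iN (ltnW jN)) s4 /(_ (ltnW iN) jN) s5.
have := turnD s5 s2 s3; have := turnD s4 s1 s3.
by lra.
Qed.

Lemma continuous_pair (R : realType) (T : topologicalType) (f g : T -> R) :
  continuous f -> continuous g -> continuous (fun x => (f x, g x) : plane R).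
Proof. by move=> cf cg x; apply: (cvg_pair (cf x) (cg x)). Qed.

(** Compactness turns the local estimate into one radius, which makes all turns small on a fine
    enough grid. *)
Lemma small_turn_uniform (R : realType) (K : set (plane R))
    (G : plane R -> plane R) :
  compact K -> continuous G -> (forall x, K x -> G x != 0) ->
  exists2 e : R, 0 < e &
    forall x y, K x -> `|x - y| < e -> small_turn (G x) (G y).
Proof.
move=> cK cG G0.
pose P (e : R) x := forall y, `|x - y| < e -> small_turn (G x) (G y).
have HP : \forall e \near (0 : R)^'+, K `<=` P e.
  apply: (compact_near_coveringP K).1 => // x Kx.
  (* With 12, the values [G x'] and [G y] differ by at most 1/6 of the norm of [G x], while [G x']
     has at least 11/12 of that norm; [small_turn_close] then applies. *)
  have n0 : 0 < `|G x| / 12 by rewrite divr_gt0// normr_gt0 G0.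
  have /cvgrPdist_lt/(_ _ n0)/nbhs_ballP[r /= r0 Hr] := cG x.
  exists (ball x (r / 2), [set e | 0 < e < r / 2]) => [|[x' e] /= [xx' /andP[e0 er]]].
    split; first by apply: nbhsx_ballx; rewrite divr_gt0.
    near=> e; apply/andP; split; near: e; first exact: nbhs_right_gt.
    by apply: nbhs_right_lt; rewrite divr_gt0.
  move=> y x'y.
  have h1 : `|G x - G x'| < `|G x| / 12.
    by apply: Hr; apply: le_ball xx'; lra.
  have h2 : `|G x - G y| < `|G x| / 12.
    apply: Hr; rewrite -ball_normE /=.
    rewrite -ball_normE /= in xx'.
    have := ler_normD (x - x') (x' - y); rewrite addrA subrK; lra.
  have h3 : `|G x' - G y| <= `|G x| / 6.
    by have := ler_distD (G x) (G x') (G y); rewrite (distrC (G x') (G x)); lra.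
  have h4 : `|G x| <= `|G x'| + `|G x| / 12.
    have := ler_normD (G x') (G x - G x'); rewrite addrC subrK; lra.
  by apply: small_turn_close; lra.
have [e [e0 He]] := @filter_ex _ _ _ _ (filterI (nbhs_right_gt (0 : R)) HP).
by exists e => // x y Kx; exact: He.
Unshelve. all: by end_near. Qed.

(** * Maps of the plane that are the identity far away *)

Definition polar (R : realType) (u : plane R) (r : R) (x : plane R) : plane R :=
  (u.1 + x.1 * r * cos (2 * pi * x.2), u.2 + x.1 * r * sin (2 * pi * x.2)).

Lemma continuous_polar (R : realType) (u : plane R) (r : R) :
  continuous (polar u r).
Proof.
apply: continuous_pair => x.
  apply: cvgD; first exact: cvg_cst.
  apply: cvgM; first by apply: cvgMr_tmp; exact: cvg_fst.
  apply: (@continuous_comp _ _ _ (fun z : plane R => 2 * pi * z.2) cos).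
    by apply: cvgMl_tmp; exact: cvg_snd.
  exact: continuous_cos.
apply: cvgD; first exact: cvg_cst.
apply: cvgM; first by apply: cvgMr_tmp; exact: cvg_fst.
apply: (@continuous_comp _ _ _ (fun z : plane R => 2 * pi * z.2) sin).
  by apply: cvgMl_tmp; exact: cvg_snd.
exact: continuous_sin.
Qed.

(* If [F] missed [u], the closed curves [F (polar u r (s, -))] would have
   constant total turn around [u]; it is zero at [s = 0] and positive at
   [s = 1]. *)
Lemma eventually_id_surjective (R : realType) (F : plane R -> plane R) (M : R) :
  continuous F -> (forall x, M < `|x| -> F x = x) ->
  forall u, exists x, F x = u.
Proof.
move=> cF Fid u; apply: contrapT => /forallNP Fu.
(* On the unit circle a cosine or a sine is at least 1/2 in absolute value, and r/2 exceeds the sum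
   of the norms of [M] and [u]. So the circle of radius [r] about [u] lies where [F] is the
   identity. *)
pose r := 2 * (`|M| + `|u| + 1).
have r0 : 0 < r by rewrite /r mulr_gt0// ltr_wpDl// addr_ge0.
pose G x := F (polar u r x) - u.
have cG : continuous G.
  move=> x; apply: cvgB; last exact: cvg_cst.
  exact: (continuous_comp (@continuous_polar _ u r x) (cF _)).
have cK : compact (`[(0 : R), 1] `*` `[(0 : R), 1]).
  by apply: compact_setX; exact: segment_compact.
have [|e e0 He] := small_turn_uniform cK cG.
  by move=> x _; rewrite subr_eq0; apply/eqP.
have [k ke] : exists k : nat, e^-1 < k%:R.
  by exists (Num.truncn e^-1).+1; rewrite truncnS_gt.
(* At least 3, so that consecutive points of the circle are less than a half turn apart. *)
pose N := k.+3.
have N0 : 0 < N%:R :> R by rewrite ltr0n.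
have Ne : N%:R^-1 < e.
  rewrite invf_plt//; apply: (lt_le_trans ke); rewrite ler_nat /N.
  by rewrite -addn3 leq_addr.
pose c i j := G (i%:R / N%:R, j%:R / N%:R).
have circle y : G (1, y) = (r * cos (2 * pi * y), r * sin (2 * pi * y)).
  rewrite /G Fid; last first.
    rewrite ltNge; apply/negP => /prod_norm_le[] /=.
    rewrite !mul1r; set C := cos _; set S := sin _ => h1 h2.
    have := cos2Dsin2 (2 * pi * y); rewrite -/C -/S.
    have [? ?] : `|u.1| <= `|u| /\ `|u.2| <= `|u| by apply/prod_norm_le.
    have aux (a z : R) : `|a| <= `|u| -> `|a + r * z| <= M -> z ^+ 2 < 1 / 4.
      move=> a1 a2.
      have : r * `|z| <= `|M| + `|u|.
        rewrite -{1}(gtr0_norm r0) -normrM.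
        have := ler_normB (a + r * z) a; rewrite addrAC subrr add0r.
        by have := ler_norm M; lra.
      have : `|z| < 1 / 2 \/ 1 / 2 <= `|z| by case: ltP; [left|right].
      case=> [z1 _|z1 z2]; last first.
        suff : r / 2 <= r * `|z| by have : r = 2 * (`|M| + `|u| + 1) by []; lra.
        by rewrite ler_pM2l//; lra.
      have -> : z ^+ 2 = `|z| ^+ 2 by rewrite -normrX ger0_norm ?sqr_ge0.
      by have := normr_ge0 z; nra.
    have := aux _ _ _ h1; have := aux _ _ _ h2; lra.
  by rewrite /polar /= !mul1r; congr pair; rewrite /= addrAC subrr add0r.
have cs i j (d f : bool) : (i + d <= N)%N -> (j + f <= N)%N ->
    small_turn (c i j) (c (i + d)%N (j + f)%N).
  move=> id jf; apply: He.
    split; rewrite /= in_itv/= divr_ge0//= ler_pdivrMr// mul1r ler_nat.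
      exact: leq_trans (leq_addr _ _) id.
    exact: leq_trans (leq_addr _ _) jf.
  apply/prod_norm_lt.
  have aux (a : nat) (b : bool) : `|a%:R / N%:R - (a + b)%:R / N%:R| < e.
    rewrite natrD mulrDl opprD addNKr normrN ger0_norm ?divr_ge0//.
    by apply: le_lt_trans Ne; case: b; rewrite ?mul1r// mul0r invr_ge0 ler0n.
  by split; exact: aux.
have cN i : c i N = c i 0.
  rewrite /c /G /polar /= divff ?gt_eqF// mul0r mulr0 mulr1.
    by rewrite cos0 sin0 [2 * pi]mulrC mulr_natr cos2pi sin2pi.
have /eqP := turn_sum_homotopy cN cs; apply/negP.
(* Row 0 is constant, its circle being shrunk to [u], so its cross products vanish. *)
rewrite [X in X != _]big1 => [|j _]; last first.
  rewrite /turn (_ : crossp _ _ = 0) ?mul0r ?atan0//.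
  by rewrite /crossp /c /G /polar /= !mul0r; ring.
have tgt0 (j : 'I_N) : 0 < turn (c N j) (c N j.+1).
  have [] : small_turn (c N j) (c N j.+1).
    by have := cs N j false true; rewrite addn0 addn1 => /(_ _ _); apply.
  set d := dotp _ _ => d0 _; rewrite -(@atan0 R) lt_atan// divr_gt0//.
  rewrite /c divff ?gt_eqF// !circle /crossp /=.
  set A := 2 * pi * (j%:R / _); set B := 2 * pi * (_ / _).
  rewrite (_ : _ - _ = r ^+ 2 * sin (B - A)); last by rewrite sinB; ring.
  rewrite mulr_gt0 ?exprn_gt0// sin_gt0_pi// /A /B -mulrBr -mulrBl.
  rewrite -natrB// subSnn mul1r !mulr_gt0 ?pi_gt0 ?invr_gt0//=.
  rewrite ltr_pdivrMr// mulrC ltr_pM2l ?pi_gt0// ltr_nat //.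
apply/negP => /eqP /esym /psumr_eq0P -/(_ (fun j _ => ltW (tgt0 j)) ord0 isT).
by move/eqP; rewrite gt_eqF.
Qed.

(** * Clamping, pasting and parametrised loops *)

Definition clamp (R : realType) (a b t : R) : R := Num.max a (Num.min t b).

Lemma clamp_itv (R : realType) (a b t : R) : a <= b -> a <= clamp a b t <= b.
Proof.
by move=> ab; rewrite /clamp le_max lexx ge_max ab ge_min lexx orbT.
Qed.

Lemma clamp_id (R : realType) (a b t : R) : a <= t <= b -> clamp a b t = t.
Proof. by move=> /andP[a1 b1]; rewrite /clamp min_l// max_r. Qed.

Lemma continuous_clamp (R : realType) (a b : R) : continuous (clamp a b).
Proof.
move=> t; apply: (@continuous_max _ _ (cst a) (fun t => Num.min t b)).
  exact: cvg_cst.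
by apply: (@continuous_min _ _ id (cst b)); [exact: cvg_id|exact: cvg_cst].
Qed.

(** Composition with the retraction of the line onto the segment trades continuity within a subspace
    for continuity everywhere. *)
Lemma continuous_clampE (R : realType) (T : topologicalType) (a b : R)
    (f : R -> T) :
  a <= b -> {within `[a, b], continuous f} -> continuous (f \o clamp a b).
Proof.
move=> ab /subspace_continuousP cf x.
apply: cvg_comp (cf (clamp a b x) _); last first.
  by rewrite /= in_itv/= clamp_itv.
move=> P wP.
have : nbhs x (clamp a b @^-1` [set y | [set` `[a, b]] y -> P y]).
  exact: continuous_clamp wP.
apply: filterS => y; apply.
by have := clamp_itv y ab; rewrite /= in_itv.
Qed.

(** The map equals f(min(t, c)) + g(max(t, c)) - f(c), since one of the first two terms is always
    the common value at [c]. *)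
Lemma continuous_paste (R : realType) (V : normedModType R) (f g : R -> V)
    (c : R) :
  continuous f -> continuous g -> f c = g c ->
  continuous (fun t => if t <= c then f t else g t).
Proof.
move=> cf cg fg.
rewrite (_ : (fun t => _) = fun t => f (Num.min t c) + g (Num.max t c) - f c).
  move=> x; apply: cvgB; last exact: cvg_cst.
  apply: cvgD.
    apply: (@continuous_comp _ _ _ (fun t => Num.min t c) f); last exact: cf.
    by apply: (@continuous_min _ _ id (cst c)); [exact: cvg_id|exact: cvg_cst].
  apply: (@continuous_comp _ _ _ (fun t => Num.max t c) g); last exact: cg.
  by apply: (@continuous_max _ _ id (cst c)); [exact: cvg_id|exact: cvg_cst].
apply/funext => t; case: leP => tc.
  by rewrite -fg addrK.
by rewrite addrAC subrr add0r.
Qed.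

(** Continuity is asked on the whole line so that compositions need no subspace topology; [clamp]
    provides it. *)
Definition loop_param (R : realType) (f : R -> plane R) (g : set (plane R)) :
    Prop :=
  [/\ continuous f, f 0 = f 1,
      forall s t, 0 <= s < 1 -> 0 <= t < 1 -> f s = f t -> s = t &
      f @` `[0, 1] = g].

Lemma loop_paramP (R : realType) (g : set (plane R)) :
  simple_closed_curve g <-> exists f, loop_param f g.
Proof.
split=> [[f [cf f01 fi fg]]|[f [cf f01 fi fg]]]; last first.
  exists f; split => //; first exact: continuous_subspaceT.
  by move=> s t; rewrite !inE /= !in_itv/= => s1 t1; exact: fi.
exists (f \o clamp 0 1).
have cE t : 0 <= t <= 1 -> clamp 0 1 t = t by exact: clamp_id.
split => /=.
- by apply: continuous_clampE.
- by rewrite !cE ?lexx ?ler01.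
- move=> s t /andP[s0 s1] /andP[t0 t1]; rewrite !cE ?s0 ?t0 ?ltW//.
  by apply: fi; rewrite inE /= in_itv/= ?s0 ?t0.
- rewrite -fg; apply/seteqP; split => x [t /=]; rewrite in_itv/= => t1 <-.
    by exists t; rewrite /= ?in_itv//= cE.
  by exists t; rewrite /= ?in_itv//= cE.
Qed.

Lemma loop_param_inj (R : realType) (f : R -> plane R) (g : set (plane R))
    (s t : R) :
  loop_param f g -> 0 < s < 1 -> 0 <= t <= 1 -> f s = f t -> s = t.
Proof.
move=> [_ f01 fi _] /andP[s0 s1] /andP[t0 t1] fst.
have [t1'|t1'] := ltP t 1; first by apply: fi => //; apply/andP; split => //; exact: ltW.
have tE : t = 1 by apply/le_anti/andP.
suff : s = 0 by move=> E; rewrite E ltxx in s0.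
apply: fi; rewrite ?lexx ?ltr01// ?(ltW s0)//.
by rewrite f01 -tE.
Qed.

(** The parameter is shifted cyclically by the parameter [c] of the new starting point. The two
    pieces are pasted at 1 - c, where [f 1] equals [f 0]. *)
Lemma loop_param_start (R : realType) (f : R -> plane R) (g : set (plane R))
    (x : plane R) :
  loop_param f g -> g x -> exists2 f', loop_param f' g & f' 0 = x.
Proof.
move=> [cf f01 fi <-] [c /=]; rewrite in_itv/= => /andP[c0 c1] <-.
have [->|c1'] := eqVneq c 1.
  by exists f; [split|].
have {}c1 : c < 1 by rewrite lt_neqAle c1' c1.
pose f' t := if t <= 1 - c then f (t + c) else f (t + c - 1).
exists f'; last by rewrite /f' add0r subr_ge0 ltW.
split.
- apply: continuous_paste; rewrite ?subrK ?subrr ?f01// => t.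
    apply: (@continuous_comp _ _ _ (fun t => t + c) f); last exact: cf.
    by apply: cvgD; [exact: cvg_id|exact: cvg_cst].
  apply: (@continuous_comp _ _ _ (fun t => t + c - 1) f); last exact: cf.
  by apply: cvgB; [apply: cvgD; [exact: cvg_id|exact: cvg_cst]|exact: cvg_cst].
- rewrite /f' add0r subr_ge0 (ltW c1).
  case: ifP => [h|_]; last by rewrite addrAC subrr add0r.
  have -> : c = 0 by lra.
  by rewrite addr0 f01.
- move=> s t /andP[s0 s1] /andP[t0 t1]; rewrite /f'.
  (* On the closed segment the only coincidence of values is between 0 and 1. *)
  have fi' a b : 0 <= a <= 1 -> 0 <= b <= 1 -> f a = f b ->
      a = b \/ a = 0 /\ b = 1 \/ a = 1 /\ b = 0.
    move=> /andP[a0 a1] /andP[b0 b1] fab.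
    have [a1'|a1'] := ltP a 1; have [b1'|b1'] := ltP b 1.
    + by left; apply: fi => //; apply/andP.
    + have bE : b = 1 by lra.
      right; left; split => //; apply: fi; rewrite ?lexx ?ltr01 ?a0//.
      by rewrite fab bE f01.
    + have aE : a = 1 by lra.
      right; right; split => //; apply: fi; rewrite ?lexx ?ltr01 ?b0//.
      by rewrite -fab aE f01.
    + by left; lra.
  case: (leP s) => hs; case: (leP t) => ht.
  + by case/fi'; [apply/andP; lra..| |]; lra.
  + by case/fi'; [apply/andP; lra..| |]; lra.
  + by case/fi'; [apply/andP; lra..| |]; lra.
  + by case/fi'; [apply/andP; lra..| |]; lra.
- apply/seteqP; split => z [t /=]; rewrite in_itv/= => /andP[t0 t1] <-.
    rewrite /f'; case: leP => h.
      by exists (t + c); rewrite //= in_itv/=; apply/andP; lra.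
    by exists (t + c - 1); rewrite //= in_itv/=; apply/andP; lra.
  have [h|h] := ltP t c.
    exists (t + 1 - c); first by rewrite /= in_itv/=; apply/andP; lra.
    rewrite /f'; case: ifP => [h'|_]; last by rewrite subrK addrK.
    by rewrite subrK (_ : t = 0) ?add0r ?f01//; lra.
  exists (t - c); first by rewrite /= in_itv/=; apply/andP; lra.
  by rewrite /f' subrK lerB.
Qed.

(** The parameters at distance at least [e] from [t] form a compact set, whose image is closed and
    misses [f t]. This yields the continuity of inverse maps. *)
Lemma param_inverse_near (R : realType) (f : R -> plane R) (a b t e : R) :
  continuous f -> a <= t <= b ->
  (forall s, a <= s <= b -> f s = f t -> s = t) -> 0 < e ->
  \forall x \near f t, forall s, a <= s <= b -> f s = x -> `|s - t| < e.
Proof.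
move=> cf tab ft e0.
pose K := `[a, b] `&` [set s | e <= `|s - t|].
have cK : compact K.
  apply: compact_closedI; first exact: segment_compact.
  apply: (@preimage_closed _ _ (fun s => `|s - t|) [set x | e <= x]).
    move=> s _; apply: (@continuous_comp _ _ _ (fun s => s - t) (@Num.norm R R)).
      by apply: cvgB; [exact: cvg_id|exact: cvg_cst].
    exact: norm_continuous.
  exact: closed_ge.
have clK : closed (f @` K).
  apply: compact_closed; first exact: norm_hausdorff.
  by apply: continuous_compact => //; exact: continuous_subspaceT.
have : nbhs (f t) (~` (f @` K)).
  apply: open_nbhs_nbhs; split; first exact: closed_openC.
  move=> [s [/=]]; rewrite in_itv/= => sab es /(ft _ sab) st.
  by move: es; rewrite st subrr normr0 leNgt e0.
apply: filterS => z nKz s sab fs; rewrite ltNge; apply/negP => es.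
by apply: nKz; exists s.
Qed.

(** * Retraction onto an arc, and boundary points of a tile *)

Lemma closure_bounded (R : realType) (U : set (plane R)) :
  bounded_set U -> exists M, forall x, closure U x -> `|x| <= M.
Proof.
move=> [M [_ HM]]; exists (M + 1) => x Ux.
have cB : closed [set x : plane R | `|x| <= M + 1].
  apply: (@preimage_closed _ _ (@Num.norm R (plane R)) [set e | e <= M + 1]).
    by move=> y _; exact: norm_continuous.
  exact: closed_le.
have /closure_id cBE := cB.
have : closure U `<=` [set x : plane R | `|x| <= M + 1].
  by rewrite cBE; apply: closureS => y Uy; apply: (HM (M + 1)) => //; rewrite ltrDl.
exact.
Qed.

(* The inverse of [f] on the arc, extended to the plane by Tietze. *)
Lemma arc_retract (R : realType) (f : R -> plane R) (a b : R) :
  a <= b -> continuous f ->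
  (forall s t, a <= s <= b -> a <= t <= b -> f s = f t -> s = t) ->
  exists r : plane R -> plane R,
    [/\ continuous r, forall x, (f @` `[a, b]) (r x) &
        forall t, a <= t <= b -> r (f t) = f t].
Proof.
move=> ab cf fi.
pose A := f @` `[a, b].
pose phi x := xget a [set t | a <= t <= b /\ f t = x].
have phiE t : a <= t <= b -> phi (f t) = t.
  move=> tab; rewrite /phi; case: xgetP => [s _ [sab fst]|/(_ t)/=].
    exact: fi.
  by move=> H; exfalso; apply: H.
have cphi : {within A, continuous phi}.
  apply/subspace_continuousP => x [t /=]; rewrite in_itv/= => tab <-.
  rewrite /from_subspace phiE//; apply/cvgrPdist_lt => e e0.
  rewrite near_withinE.
  have := param_inverse_near cf tab (fun s sab => fi s t sab tab) e0.
  apply: filterS => z Hz [s /=]; rewrite in_itv/= => sab fs.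
  by rewrite -fs phiE// distrC; exact: Hz.
have clA : closed A.
  apply: compact_closed; first exact: norm_hausdorff.
  apply: continuous_compact; first exact: continuous_subspaceT.
  exact: segment_compact.
have M0 : 0 < `|a| + `|b| + 1 by rewrite ltr_wpDl// addr_ge0.
have phib x : A x -> `|phi x| <= `|a| + `|b| + 1.
  move=> [t /=]; rewrite in_itv/= => tab <-; rewrite phiE// ler_norml.
  move: tab => /andP[ta tb]; have := ler_norm b; have := lerNnormlW (lexx `|a|).
  have := normr_ge0 a; have := normr_ge0 b.
  by move=> *; apply/andP; split; lra.
have [h [hphi ch _]] := @continuous_bounded_extension (plane R) R
  pseudometric_normal A clA phi _ M0 cphi phib.
(* The Tietze extension [h] may leave [a, b]; clamping brings its values back to parameters of the
   arc. *)
exists (f \o clamp a b \o h); split => [x|x|t tab].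
- apply: (@continuous_comp _ _ _ h (f \o clamp a b)); first exact: ch.
  apply: continuous_clampE => //; exact: continuous_subspaceT.
- by exists (clamp a b (h x)) => //=; rewrite in_itv/= clamp_itv.
- have fA : A (f t) by exists t; rewrite //= in_itv.
  by rewrite /= -hphi ?inE// phiE// clamp_id.
Qed.

Lemma curve_bounds_closure (R : realType) (g U : set (plane R)) :
  curve_bounds g U -> U `|` g = closure U.
Proof.
move=> [_ _ <-]; apply/seteqP; split => x; first by case=> [/subset_closure|[]].
by have [Ux|nUx] := pselect (U x); [left|right].
Qed.

(* Were [x] interior to [U `|` g], a retraction onto the complementary arc
   would extend by the identity to a non-surjective map that is the identity
   far away. *)
Lemma curve_boundary (R : realType) (g U : set (plane R)) :
  simple_closed_curve g -> curve_bounds g U -> U !=set0 ->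
  interior (U `|` g) `&` g = set0.
Proof.
move=> /loop_paramP[f0 f0P] gU0; have [oU bU clU] := gU0; move=> [u Uu].
apply/seteqP; split => // x [ix gx].
have [f fP f0x] := loop_param_start f0P gx.
have TE : U `|` g = closure U.
  exact: curve_bounds_closure.
have clT : closed (U `|` g) by rewrite TE; exact: closed_closure.
set T := U `|` g in ix clT TE *.
have gU y : g y -> ~ U y by rewrite -clU => -[].
have [cf f01 fi fg] := fP.
(* Both ends of the parameter range map into the interior of [T]. What remains is the arc over
   [e, 1 - e], on which [f] is injective. *)
have [e e0 [e1 He]] : exists2 e : R, 0 < e & e < 1 / 2 /\
    forall t, 0 <= t <= e \/ 1 - e <= t <= 1 -> interior T (f t).
  have oT : open (interior T) by exact: open_interior.
  have n0 : nbhs (0 : R) (f @^-1` interior T).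
    by apply: cf; rewrite f0x; exact: open_nbhs_nbhs.
  have n1 : nbhs (1 : R) (f @^-1` interior T).
    by apply: cf; rewrite -f01 f0x; exact: open_nbhs_nbhs.
  move: n0 n1 => /nbhs_ballP[d0 /= d00 H0] /nbhs_ballP[d1 /= d10 H1].
  pose e := Num.min (Num.min d0 d1) (1/2) / 2.
  have ep : 0 < Num.min (Num.min d0 d1) (1/2) by rewrite !lt_min d00 d10/=; lra.
  have [[ed0 ed1 eh] e0] : [/\ 2 * e <= d0, 2 * e <= d1 & 2 * e <= 1 / 2] /\ 0 < e.
    have -> : 2 * e = Num.min (Num.min d0 d1) (1/2) by rewrite /e; field.
    by split; [split; rewrite !ge_min lexx ?orbT|rewrite /e divr_gt0].
  exists e => //; split; first by lra.
  move=> t [/andP[t0 t1]|/andP[t0 t1]].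
    by apply: H0; rewrite -ball_normE /= sub0r normrN ger0_norm//; lra.
  by apply: H1; rewrite -ball_normE /= ger0_norm; lra.
have [||r [cr rA rid]] := @arc_retract R f e (1 - e) _ cf; first by lra.
  by move=> s t /andP[s0 s1] /andP[t0 t1]; apply: fi; apply/andP; lra.
have rg y : g (r y).
  have [t /=] := rA y; rewrite in_itv/= => /andP[t0 t1] <-.
  by rewrite -fg; exists t => //=; rewrite in_itv/=; apply/andP; lra.
(* A point of [T] that is not interior lies on [g], since [U] is open, and its parameter lies in
   [e, 1 - e]. *)
have rT y : T y -> ~ interior T y -> r y = y.
  move=> [Uy|gy] niy.
    exfalso; apply: niy; apply: (@interiorS _ U); first exact: subsetUl.
    by rewrite ((interior_id U).1 oU).
  move: gy niy; rewrite -fg => -[t /=]; rewrite in_itv/= => /andP[t0 t1] <- nit.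
  apply: rid; apply/andP; split; rewrite leNgt; apply/negP => h; apply: nit.
    by apply: He; left; apply/andP; lra.
  by apply: He; right; apply/andP; lra.
(* By [rT] the two branches agree where [T] meets the closure of its complement, so [F] is
   continuous. *)
pose F y := if pselect (T y) then r y else y.
have cF : continuous F.
  apply/continuous_subspace_setT.
  have -> : [set: plane R] = T `|` closure (~` T).
    apply/seteqP; split => // y _.
    by have [Ty|nTy] := pselect (T y); [left|right; exact: subset_closure].
  apply: withinU_continuous => //; first exact: closed_closure.
    apply: (@subspace_eq_continuous _ T _ r F); last first.
      exact: continuous_subspaceT.
    by move=> y; rewrite inE /F => Ty; case: pselect.
  apply: (@subspace_eq_continuous _ (closure (~` T))
    (plane R : topologicalType) (fun y : plane R => y) F).
    move=> y; rewrite inE closure_setC /F => niy; case: pselect => // Ty.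
    by rewrite rT.
  have cid : continuous (@id (plane R)) by move=> y.
  exact: continuous_subspaceT cid.
have [M HM] : exists M, forall y, M < `|y| -> F y = y.
  have [M TM] := closure_bounded bU.
  exists M => y My; rewrite /F; case: pselect => // Ty.
  by have := TM y; rewrite -TE => /(_ Ty); rewrite leNgt My.
have [y] := eventually_id_surjective cF HM u.
rewrite /F; case: pselect => /= [_ ru|nTy yu].
  by apply: (gU (r y)) => //; rewrite ru.
by apply: nTy; left; rewrite yu.
Qed.

(** * Reflection in a line *)

(** The coordinate of [x] along [normal u]: the signed distance to the line is this times the
    Euclidean length of [u]. *)
Definition side (R : realType) (a u x : plane R) : R :=
  ((x.1 - a.1) * u.2 - (x.2 - a.2) * u.1) / (u.1 ^+ 2 + u.2 ^+ 2).

Definition normal (R : realType) (u : plane R) : plane R := (u.2, - u.1).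

Section Reflection.
Variables (R : realType) (a u : plane R).
Hypothesis u0 : u != 0.

Lemma direction_neq0 : u.1 ^+ 2 + u.2 ^+ 2 != 0.
Proof.
rewrite paddr_eq0 ?sqr_ge0// !sqrf_eq0.
by apply: contra u0; case: u => p q /= /andP[/eqP-> /eqP->].
Qed.

Lemma reflectionE x : reflection a u x = x - (2 * side a u x) *: normal u.
Proof.
have := direction_neq0; move: a u x => [a1 a2] [u1 u2] [x1 x2] /= D.
rewrite /reflection /side /normal /=; congr pair => /=.
  by rewrite /GRing.scale /=; field.
by rewrite /GRing.scale /=; field.
Qed.

Lemma side_shift x t : side a u (x + t *: normal u) = side a u x + t.
Proof.
have := direction_neq0; move: a u x => [a1 a2] [u1 u2] [x1 x2] /= D.
by rewrite /side /normal /= /GRing.scale /=; field.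
Qed.

Lemma side_affine x y t :
  side a u (x + t *: (y - x)) = side a u x + t * (side a u y - side a u x).
Proof.
have := direction_neq0; move: a u x y => [a1 a2] [u1 u2] [x1 x2] [y1 y2] /= D.
by rewrite /side /= /GRing.scale /=; field.
Qed.

Lemma side_reflection x : side a u (reflection a u x) = - side a u x.
Proof. by rewrite reflectionE -scaleNr side_shift; ring. Qed.

Lemma reflectionK : involutive (reflection a u).
Proof.
move=> x; rewrite [LHS]reflectionE side_reflection reflectionE.
by rewrite mulrN scaleNr opprK subrK.
Qed.

Lemma reflection_fixed x : reflection a u x = x <-> side a u x = 0.
Proof.
split=> [xx|x0]; last by rewrite reflectionE x0 mulr0 scale0r subr0.
by have := side_reflection x; rewrite xx; lra.
Qed.

Lemma side_line x y z : side a u x = 0 -> side a u y = 0 -> side a u z = 0 ->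
  x <> y -> exists t, z = x + t *: (y - x).
Proof.
have on p : side a u p = 0 ->
    exists s, p = (a.1 + s * u.1, a.2 + s * u.2).
  move=> p0.
  exists (((p.1 - a.1) * u.1 + (p.2 - a.2) * u.2) / (u.1 ^+ 2 + u.2 ^+ 2)).
  have pE : p = (a.1 + ((p.1 - a.1) * u.1 + (p.2 - a.2) * u.2) /
      (u.1 ^+ 2 + u.2 ^+ 2) * u.1 + side a u p * u.2,
      a.2 + ((p.1 - a.1) * u.1 + (p.2 - a.2) * u.2) /
      (u.1 ^+ 2 + u.2 ^+ 2) * u.2 - side a u p * u.1).
    have := direction_neq0; rewrite /side.
    move: a u p {p0} => [a1 a2] [u1 u2] [x1 x2] /= D.
    by congr pair; field.
  by rewrite {1}pE p0 !mul0r addr0 subr0.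
move=> /on[sx ->] /on[sy ->] /on[sz ->] xy.
have sxy : sy - sx != 0.
  by rewrite subr_eq0; apply: contra_notN xy => /eqP->.
exists ((sz - sx) / (sy - sx)).
by congr pair; rewrite /= /GRing.scale /=; field.
Qed.

Lemma continuous_side : continuous (side a u).
Proof.
move=> x; apply: cvgMr_tmp; apply: cvgB; apply: cvgMr_tmp; apply: cvgB.
- exact: cvg_fst.
- exact: cvg_cst.
- exact: cvg_snd.
- exact: cvg_cst.
Qed.

Lemma continuous_reflection : continuous (reflection a u).
Proof.
rewrite (funext reflectionE) => x; apply: cvgB; first exact: cvg_id.
by apply: cvgZr_tmp; apply: cvgMl_tmp; exact: continuous_side.
Qed.

Lemma reflection_isometry : plane_isometry (reflection a u).
Proof.
move=> x y; rewrite /edist; congr Num.sqrt.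
have := direction_neq0; move: a u x y => [a1 a2] [u1 u2] [x1 x2] [y1 y2] /= D.
by field.
Qed.

Lemma sideN x : side a (- u) x = - side a u x.
Proof.
have := direction_neq0; move: a u x => [a1 a2] [u1 u2] [x1 x2] /= D.
by rewrite /side /=; field; rewrite ?sqrrN D.
Qed.

Lemma reflectionN x : reflection a (- u) x = reflection a u x.
Proof.
have := direction_neq0; move: a u x => [a1 a2] [u1 u2] [x1 x2] /= D.
by congr pair => /=; field; rewrite ?sqrrN D.
Qed.

End Reflection.

(** [d] is the sup-norm distance to the complement of [U], which is 1-Lipschitz. *)
Lemma interior_radius (R : realType) (U : set (plane R)) :
  open U -> ~` U !=set0 ->
  exists d : plane R -> R, [/\ continuous d, forall x, U x -> 0 < d x &
    forall x y, `|x - y| < d x -> U y].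
Proof.
move=> oU [w nUw].
pose D x := [set `|x - y| | y in ~` U].
have D0 x : D x !=set0 by exists `|x - w|, w.
have Dlb x : has_lbound (D x) by exists 0 => _ [y _ <-].
exists (fun x => inf (D x)); split => [|x Ux|x y xy].
- have lip x y : inf (D x) <= `|x - y| + inf (D y).
    rewrite -lerBlDl; apply: lb_le_inf => // _ [z nUz <-].
    rewrite lerBlDl; apply: le_trans (ler_distD y x z).
    by apply: ge_inf => //; exists z.
  move=> x; apply/cvgrPdist_lt => e e0.
  near=> y.
  have xy : `|x - y| < e by near: y; exact: (@cvgr_dist_lt).
  have := lip x y; have := lip y x; rewrite (distrC y x) => l1 l2.
  by rewrite ltr_norml; apply/andP; split; lra.
- have /nbhs_ballP[e /= e0 He] := open_nbhs_nbhs (conj oU Ux).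
  apply: (lt_le_trans e0); apply: lb_le_inf => // _ [z nUz <-].
  rewrite leNgt; apply/negP => xz; apply: nUz; apply: He.
  by rewrite -ball_normE.
- apply: contrapT => nUy; move: xy; rewrite ltNge => /negP; apply.
  by apply: ge_inf => //; exists y.
Unshelve. all: by end_near. Qed.

(** * Loops symmetric in a line *)

Definition half_arc (R : realType) (a u : plane R) (g : set (plane R))
    (e : R -> plane R) : Prop :=
  [/\ continuous e,
      forall s t, 0 <= s <= 1 -> 0 <= t <= 1 -> e s = e t -> s = t,
      side a u (e 0) = 0 /\ side a u (e 1) = 0,
      forall t, 0 < t < 1 -> 0 < side a u (e t) &
      g `&` [set x | 0 <= side a u x] = e @` `[0, 1]].

Lemma ivt_zero (R : realType) (h : R -> R) (a b : R) :
  a <= b -> continuous h -> h a <= 0 <= h b \/ h b <= 0 <= h a ->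
  exists2 c, a <= c <= b & h c = 0.
Proof.
move=> ab ch hab; have [||c] := @IVT R h a b 0 ab.
- exact: continuous_subspaceT.
- by rewrite ge_min le_max; case: hab => /andP[-> ->]; rewrite ?orbT.
- by rewrite in_itv/= => cab hc; exists c.
Qed.

(* By the intermediate value theorem: halfway between the values at [0] and
   [1/2] is attained on both halves. *)
Lemma loop_not_in_line (R : realType) (a u : plane R) (f : R -> plane R)
    (g : set (plane R)) :
  u != 0 -> loop_param f g -> ~ forall t, 0 <= t <= 1 -> side a u (f t) = 0.
Proof.
move=> u0 fP f0; have [cf f01 fi _] := fP.
pose p t := f t - f 0.
have half : f 0 <> f (1 / 2).
  by move=> /fi; rewrite lexx ltr01 => /(_ isT) H; have := H ltac:(apply/andP; lra); lra.
pose w := f (1 / 2) - f 0.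
pose W := w.1 ^+ 2 + w.2 ^+ 2.
have W0 : W != 0.
  rewrite paddr_eq0 ?sqr_ge0// !sqrf_eq0; apply: contra_notN half.
  case/andP => /eqP w1 /eqP w2; apply/esym/eqP; rewrite -subr_eq0 -/w; apply/eqP.
  by rewrite [w]surjective_pairing w1 w2.
have lin (v : plane R) (s : R) : v.1 ^+ 2 + v.2 ^+ 2 != 0 ->
    ((s *: v).1 * v.1 + (s *: v).2 * v.2) / (v.1 ^+ 2 + v.2 ^+ 2) = s.
  by case: v => v1 v2 /= D; rewrite /GRing.scale /=; field.
(* The coordinate along [w], shifted to be -1/2 at [f 0] and 1/2 at [f (1 / 2)], so that the halfway
   value is 0. *)
pose h t := ((f t - f 0).1 * w.1 + (f t - f 0).2 * w.2) / W - 1 / 2.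
have fE t : 0 <= t <= 1 -> f t = f 0 + (h t + 1 / 2) *: w.
  move=> t1; have [||||s fs] := @side_line _ a u u0 (f 0) (f (1 / 2)) (f t).
  - by apply: f0; rewrite lexx ler01.
  - by apply: f0; apply/andP; lra.
  - exact: f0.
  - exact: half.
  rewrite {1}fs -/w; congr (_ + _ *: _).
  by rewrite /h subrK fs -/w addrAC subrr add0r /W lin.
have h0 : h 0 = - (1 / 2) by rewrite /h subrr /= !mul0r; lra.
have h12 : h (1 / 2) = 1 / 2.
  by rewrite /h -/w -!expr2 divff//; lra.
have ch : continuous h.
  have cp : continuous (fun t => f t - f 0).
    by move=> t; apply: cvgB; [exact: cf|exact: cvg_cst].
  move=> t; apply: cvgB; last exact: cvg_cst.
  apply: cvgMr_tmp; apply: cvgD; apply: cvgMr_tmp.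
    apply: (@continuous_comp _ _ _ (fun t => f t - f 0)
      (fun x : plane R => x.1)); first exact: cp.
    exact: cvg_fst.
  apply: (@continuous_comp _ _ _ (fun t => f t - f 0)
    (fun x : plane R => x.2)); first exact: cp.
  exact: cvg_snd.
have h1 : h 1 = - (1 / 2) by rewrite -h0 /h f01.
have [||c1 /andP[c10 c11] hc1] := @ivt_zero R h 0 (1 / 2) _ ch; first by lra.
  by left; rewrite h0 h12; apply/andP; lra.
have [||c2 /andP[c20 c21] hc2] := @ivt_zero R h (1 / 2) 1 _ ch; first by lra.
  by right; rewrite h1 h12; apply/andP; lra.
have c2lt : c2 < 1.
  by rewrite lt_neqAle c21 andbT; apply/eqP => c2E; move: hc2; rewrite c2E h1; lra.
have c12 : c1 = c2.
  apply: fi; [by apply/andP; lra..|].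
  by rewrite (fE c1) ?(fE c2) ?hc1 ?hc2//; apply/andP; lra.
(* The common parameter is at most and at least 1/2, where [h] does not vanish. *)
have : c1 = 1 / 2 by lra.
by move=> cE; move: hc1; rewrite cE h12; lra.
Qed.

(** A point of the loop and its mirror image have opposite sides, so the loop meets the axis between
    them; it is restarted there. *)
Lemma symmetric_loop_start (R : realType) (a u : plane R) (g : set (plane R)) :
  u != 0 -> simple_closed_curve g -> (forall x, g x -> g (reflection a u x)) ->
  exists2 f, loop_param f g & side a u (f 0) = 0.
Proof.
move=> u0 /loop_paramP[f fP] gs; have [cf f01 fi fg] := fP.
have gf t : 0 <= t <= 1 -> g (f t) by move=> t1; rewrite -fg; exists t.
have [t] : (f @` `[0, 1]) (reflection a u (f 0)).
  by rewrite fg; apply: gs; apply: gf; rewrite lexx ler01.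
rewrite /= in_itv/= => /andP[t0 t1] ft.
have csf : continuous (side a u \o f).
  move=> x; apply: (@continuous_comp _ _ _ f (side a u)); first exact: cf.
  exact: continuous_side.
have [|c /andP[c0 c1] sc] := ivt_zero t0 csf.
  rewrite /= ft side_reflection// oppr_le0 oppr_ge0 !andbb.
  by have [] := leP (side a u (f 0)) 0; [left|move=> /ltW; right].
have [f' f'P f'0] := loop_param_start fP (gf c ltac:(by apply/andP; lra)).
by exists f'; rewrite ?f'0.
Qed.

(* The reflection induces a decreasing involution [tau] of the parameters in
   [(0, 1)]; its fixed point is the second point of the curve on the axis. *)
Lemma symmetric_loop_fold (R : realType) (a u : plane R) (f : R -> plane R)
    (g : set (plane R)) :
  u != 0 -> loop_param f g -> side a u (f 0) = 0 ->
  (forall x, g x -> g (reflection a u x)) ->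
  exists c, [/\ 0 < c < 1, side a u (f c) = 0,
    forall t, 0 < t < c -> side a u (f t) != 0 &
    forall t, c < t < 1 -> exists2 s, 0 < s < c & f t = reflection a u (f s)].
Proof.
move=> u0 fP f0 gs; have [cf f01 fi fg] := fP.
have rf0 : reflection a u (f 0) = f 0 by apply/(reflection_fixed a u0).
have tex t : 0 < t < 1 -> exists s, 0 < s < 1 /\ f s = reflection a u (f t).
  move=> t1; have : g (reflection a u (f t)).
    apply: gs; rewrite -fg; exists t => //=; rewrite in_itv/=.
    by move: t1 => /andP[? ?]; apply/andP; lra.
  rewrite -fg => -[s /=]; rewrite in_itv/= => /andP[s0 s1] fs.
  have ne : reflection a u (f t) <> f 0.
    rewrite -rf0 => /(inv_inj (reflectionK a u0)) ft0.
    have := loop_param_inj fP t1 _ ft0; rewrite lexx ler01 => /(_ isT) tE.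
    by move: t1; rewrite tE ltxx.
  exists s; split => //; rewrite !lt_neqAle s0 s1 !andbT.
  apply/andP; split; apply/eqP => sE; apply: ne; rewrite -fs.
    by rewrite sE.
  by rewrite sE f01.
pose tau t := xget 0 [set s | 0 < s < 1 /\ f s = reflection a u (f t)].
have tauP t : 0 < t < 1 -> 0 < tau t < 1 /\ f (tau t) = reflection a u (f t).
  move=> /tex[s Hs]; rewrite /tau; case: xgetP => [r _ //|/(_ s)].
  by move=> H; exfalso; apply: H.
have closed01 (t : R) : 0 < t < 1 -> 0 <= t <= 1 by move=> /andP[? ?]; apply/andP; lra.
have tauK t : 0 < t < 1 -> tau (tau t) = t.
  move=> t1; have [s1 fs] := tauP t t1; have [r1 fr] := tauP _ s1.
  apply: (loop_param_inj fP r1 (closed01 _ t1)).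
  by rewrite fr fs reflectionK.
have tau_inj : {in `]0, 1[ &, injective tau}.
  move=> s t; rewrite !in_itv/= => s1 t1 st.
  by rewrite -(tauK s) // st tauK.
have ctau : {within [set` `]0, 1[], continuous tau}.
  apply/subspace_continuousP => t /=; rewrite in_itv/= => t1.
  have [s1 fs] := tauP t t1.
  rewrite /from_subspace; apply/cvgrPdist_lt => e e0; rewrite near_withinE.
  have fu r : 0 <= r <= 1 -> f r = f (tau t) -> r = tau t.
    by move=> r1 fr; apply/esym/(loop_param_inj fP s1 r1).
  have := param_inverse_near cf (closed01 _ s1) fu e0.
  rewrite fs => Hn.
  have : \forall x \near t, forall s, 0 <= s <= 1 -> f s = reflection a u (f x) ->
      `|s - tau t| < e.
    apply: (@continuous_comp _ _ _ f (reflection a u) t _ _ _ Hn).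
      exact: cf.
    exact: continuous_reflection.
  apply: filterS => x Hx /=; rewrite in_itv/= => x1.
  have [y1 fy] := tauP x x1.
  by rewrite distrC; apply: Hx => //; exact: closed01.
have side_tau t : 0 < t < 1 -> side a u (f t) = 0 <-> tau t = t.
  move=> t1; have [s1 fs] := tauP t t1; split=> [/(reflection_fixed a u0) rt|tt].
    by apply: (loop_param_inj fP s1 (closed01 _ t1)); rewrite fs.
  by apply/(reflection_fixed a u0); rewrite -fs tt.
have [inc|dec] := itv_continuous_inj_mono ctau tau_inj.
  (* An increasing involution is the identity, which would put the whole loop on the axis. *)
  exfalso; apply: (@loop_not_in_line R a u f g u0 fP) => t /andP[t0 t1].
  have [->//|tn0] := eqVneq t 0.
  have [->|tn1] := eqVneq t 1; first by rewrite -f01.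
  have t01 : 0 < t < 1 by rewrite !lt_neqAle eq_sym tn0 tn1 t0 t1.
  have [s1 fs] := tauP t t01.
  apply/side_tau => //; case: (ltgtP (tau t) t) => // h.
    by have := inc _ _ _ _ h; rewrite tauK// !in_itv/= s1 t01 => /(_ isT isT); lra.
  by have := inc _ _ _ _ h; rewrite tauK// !in_itv/= s1 t01 => /(_ isT isT); lra.
have {}dec s t : 0 < s < 1 -> 0 < t < 1 -> s < t -> tau t < tau s.
  by move=> s1 t1 st; apply: dec; rewrite ?in_itv.
(* [tau t - t] takes opposite values at 1/2 and at [tau (1 / 2)], so it vanishes between them. *)
have [c c1 cc] : exists2 c, 0 < c < 1 & tau c = c.
  have h1 : 0 < (1 / 2 : R) < 1 by apply/andP; lra.
  have [b1 _] := tauP _ h1.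
  have cd (p q : R) : 0 < p -> q < 1 ->
      {within `[p, q], continuous (fun t => tau t - t)}.
    have cd01 : {within [set` `]0, 1[], continuous (fun t => tau t - t)}.
      apply/subspace_continuousP => t t1; apply: cvgB.
        by move/subspace_continuousP: ctau; exact.
      by apply: cvg_within_filter; exact: cvg_id.
    move=> p0 q1; apply: continuous_subspaceW cd01.
    by move=> x /=; rewrite !in_itv/= => /andP[? ?]; apply/andP; lra.
  have bb := tauK _ h1; set b := tau (1 / 2) in b1 bb.
  have : exists2 c, 0 < c < 1 & tau c - c = 0.
    move: b1 => /andP[b0 b1].
    have [hb|hb] := leP (1 / 2) b.
      have [||c] := @IVT R (fun t => tau t - t) (1 / 2) b 0 hb.
      - by apply: cd; lra.
      - by rewrite bb -/b ge_min le_max; apply/andP; split; apply/orP; [right|left]; lra.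
      - rewrite in_itv/= => /andP[? ?] ?; exists c => //; apply/andP; lra.
    have [||c] := @IVT R (fun t => tau t - t) b (1 / 2) 0 (ltW hb).
    - by apply: cd; lra.
    - by rewrite bb -/b ge_min le_max; apply/andP; split; apply/orP; [right|left]; lra.
    - rewrite in_itv/= => /andP[? ?] ?; exists c => //; apply/andP; lra.
  by move=> [c c1 cc]; exists c => //; lra.
have c01 := c1; move: c1 => /andP[c0 c1].
exists c; split => //.
- exact/side_tau.
- move=> t /andP[t0 tc].
  have t1 : 0 < t < 1 by apply/andP; lra.
  apply/eqP => /side_tau -/(_ t1) tt.
  by have := dec _ _ t1 c01 tc; rewrite tt cc; lra.
- move=> t /andP[ct t1].
  have t01 : 0 < t < 1 by apply/andP; lra.
  have [/andP[s0 s1] fs] := tauP _ t01.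
  exists (tau t); last by rewrite fs reflectionK.
  by rewrite s0 -[X in _ < X]cc; exact: dec.
Qed.

(** The piece of the loop over [0, c] stays on one side of the axis. It or its mirror image is the
    arc, and the folding shows that nothing else of the loop lies on that side. *)
Lemma symmetric_loop_half_arc (R : realType) (a u : plane R) (g : set (plane R)) :
  u != 0 -> simple_closed_curve g -> (forall x, g x -> g (reflection a u x)) ->
  exists e, half_arc a u g e.
Proof.
move=> u0 gC gs; have [f fP f0] := symmetric_loop_start u0 gC gs.
have [c [/andP[c0 c1] fc fne fold]] := symmetric_loop_fold u0 fP f0 gs.
have [cf f01 fi fg] := fP.
have gf t : 0 <= t <= 1 -> g (f t) by move=> t1; rewrite -fg; exists t.
have f1 : side a u (f 1) = 0 by rewrite -f01.
have csf : continuous (side a u \o f).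
  move=> x; apply: (@continuous_comp _ _ _ f (side a u)); first exact: cf.
  exact: continuous_side.
(* The side cannot change sign on (0, c), where it has no zero. *)
have sgn s t : 0 < s < c -> 0 < t < c -> 0 < side a u (f s) -> 0 < side a u (f t).
  move=> /andP[s0 sc] /andP[t0 tc] fs; rewrite ltNge; apply/negP => ft.
  have [st|/ltW st] := leP s t.
    have [|r /andP[r0 r1]] := ivt_zero st csf.
      by right; rewrite /= ft ltW.
    by apply/eqP/fne; apply/andP; lra.
  have [|r /andP[r0 r1]] := ivt_zero st csf.
    by left; rewrite /= ft ltW.
  by apply/eqP/fne; apply/andP; lra.
have scale (t : R) : 0 <= t <= 1 -> 0 <= c * t <= c.
  by move=> /andP[t0 t1]; rewrite mulr_ge0 ?(ltW c0)//= ler_piMr ?(ltW c0).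
have scale' (t : R) : 0 < t < 1 -> 0 < c * t < c.
  by move=> /andP[t0 t1]; rewrite mulr_gt0//= gtr_pMr.
have unscale (t : R) : 0 <= t <= c -> 0 <= t / c <= 1 /\ c * (t / c) = t.
  move=> /andP[t0 tc]; rewrite divr_ge0 ?(ltW c0)// ler_pdivrMr// mul1r tc.
  by split=> //; rewrite mulrC divfK// gt_eqF.
pose e t := f (c * t).
have ce : continuous e.
  move=> t; apply: (@continuous_comp _ _ _ (fun t => c * t) f); last exact: cf.
  by apply: cvgMl_tmp; exact: cvg_id.
have ei s t : 0 <= s <= 1 -> 0 <= t <= 1 -> e s = e t -> s = t.
  move=> /scale /andP[s0 s1] /scale /andP[t0 t1] st.
  by apply: (mulfI (lt0r_neq0 c0)); apply: fi => //; apply/andP; lra.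
have e0 : side a u (e 0) = 0 by rewrite /e mulr0.
have e1 : side a u (e 1) = 0 by rewrite /e mulr1.
have ge t : 0 <= t <= 1 -> g (e t).
  by move=> /scale /andP[t0 t1]; apply: gf; apply/andP; lra.
have h1 : 0 < (1 / 2 : R) < 1 by apply/andP; lra.
have [epos|eneg] : 0 < side a u (e (1 / 2)) \/ side a u (e (1 / 2)) < 0.
  have := fne _ (scale' _ h1); rewrite -/(e (1 / 2)) neq_lt.
  by case/orP; [right|left].
- have pos s : 0 < s < c -> 0 < side a u (f s).
    by move=> sc; apply: sgn epos => //; exact: scale'.
  exists e; split => //.
    by move=> t t1; apply: pos; exact: scale'.
  apply/seteqP; split => [x [gx /= x0]|x [t /=]]; last first.
    rewrite in_itv/= => t1 <-; split; first exact: ge.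
    have [->|tn0] := eqVneq t 0; first by rewrite /= e0.
    have [->|tn1] := eqVneq t 1; first by rewrite /= e1.
    apply/ltW/pos/scale'; rewrite !lt_neqAle eq_sym tn0 tn1.
    by move: t1 => /andP[-> ->].
  move: gx x0; rewrite -fg => -[t /=]; rewrite in_itv/= => /andP[t0 t1] <- ft.
  have [tc|ct] := leP t c.
    have [t'1 tE] := unscale t ltac:(by apply/andP).
    by exists (t / c); rewrite /= ?in_itv// /e tE.
  have [tE|tn1] := eqVneq t 1.
    by exists 0; rewrite /= ?in_itv/= ?lexx ?ler01// /e mulr0 tE.
  have [|s sc fs] := fold t; first by rewrite ct lt_neqAle tn1.
  by move: ft; rewrite fs side_reflection//; have := pos s sc; lra.
- have neg s : 0 < s < c -> side a u (f s) < 0.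
    move=> sc; rewrite ltNge; apply/negP => fs.
    have fs' : 0 < side a u (f s) by rewrite lt_neqAle eq_sym fne.
    by have := sgn _ _ sc (scale' _ h1) fs'; rewrite -/(e (1 / 2)); lra.
  have rfix x : side a u x = 0 -> reflection a u x = x.
    by move/(reflection_fixed a u0).
  (* The piece over [0, c] lies on the negative side here, so its mirror image is taken. *)
  exists (reflection a u \o e); split => /=.
  + move=> t; apply: (@continuous_comp _ _ _ e (reflection a u)); first exact: ce.
    exact: continuous_reflection.
  + by move=> s t s1 t1 /(inv_inj (reflectionK a u0)); exact: ei.
  + by rewrite !side_reflection// e0 e1 oppr0.
  + by move=> t t1; rewrite side_reflection// oppr_gt0; apply/neg/scale'.
  + apply/seteqP; split => [x [gx /= x0]|x [t /=]]; last first.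
      rewrite in_itv/= => t1 <-; split; first exact/gs/ge.
      rewrite /= side_reflection// oppr_ge0.
      have [->|tn0] := eqVneq t 0; first by rewrite e0.
      have [->|tn1] := eqVneq t 1; first by rewrite e1.
      apply/ltW/neg/scale'; rewrite !lt_neqAle eq_sym tn0 tn1.
      by move: t1 => /andP[-> ->].
    move: gx x0; rewrite -fg => -[t /=]; rewrite in_itv/= => /andP[t0 t1] <- ft.
    have [tE|tn0] := eqVneq t 0.
      by exists 0; rewrite /= ?in_itv/= ?lexx ?ler01// rfix// /e mulr0 tE.
    have [tE|tn1] := eqVneq t 1.
      by exists 0; rewrite /= ?in_itv/= ?lexx ?ler01// rfix// /e mulr0 tE.
    have [tE|tnc] := eqVneq t c.
      by exists 1; rewrite /= ?in_itv/= ?lexx ?ler01// rfix// /e mulr1 tE.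
    have [tc|ct] := leP t c.
      have t0c : 0 < t < c by rewrite !lt_neqAle eq_sym tn0 t0 tnc tc.
      by have := neg t t0c; lra.
    have [|s /andP[s0 sc] fs] := fold t; first by rewrite ct lt_neqAle tn1.
    have [s'1 sE] := unscale s ltac:(by apply/andP; lra).
    by exists (s / c); rewrite /= ?in_itv// /e sE.
Qed.

(** * One half of a symmetric tile *)

Lemma continuous_line (R : realType) (x y : plane R) :
  continuous (fun t : R => x + t *: (y - x)).
Proof.
move=> t; apply: cvgD; first exact: cvg_cst.
by apply: cvgZr_tmp; exact: cvg_id.
Qed.

Lemma nbhs_normal (R : realType) (u x : plane R) (B : set (plane R)) :
  nbhs x B ->
  exists2 t, 0 < t & B (x + t *: normal u) /\ B (x - t *: normal u).
Proof.
move=> /nbhs_ballP[d /= d0 Hd].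
pose t := d / 2 / (`|normal u| + 1).
have n0 : 0 < `|normal u| + 1 by rewrite ltr_wpDl.
have t0 : 0 < t by rewrite !divr_gt0.
have td : `|t *: normal u| < d.
  rewrite normrZ gtr0_norm//.
  have : t * (`|normal u| + 1) = d / 2 by rewrite divfK// gt_eqF.
  by rewrite mulrDr mulr1; lra.
exists t => //; split; apply: Hd; rewrite -ball_normE /= opprD addNKr ?opprK//.
by rewrite normrN.
Qed.

Section HalfTile.
Variables (R : realType) (a u : plane R) (g U : set (plane R)) (e : R -> plane R).
Hypothesis u0 : u != 0.
Hypothesis gU : curve_bounds g U.
Hypothesis cU : contractible U.
Hypothesis sU : forall x, U x -> U (reflection a u x).
Hypothesis ge : half_arc a u g e.

(** An affine parameter on the axis, with 0 and 1 at the ends of the arc; [0, 1] gives the cutting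
    chord. *)
Let line t := e 0 + t *: (e 1 - e 0).

Let side_line0 t : side a u (line t) = 0.
Proof.
have [_ _ [h0 h1] _ _] := ge.
by rewrite side_affine// h0 h1 subrr mulr0 addr0.
Qed.

Let e01 : e 0 <> e 1.
Proof.
have [_ ei _ _ _] := ge => /ei; rewrite !lexx !ler01 => /(_ isT isT) /esym/eqP.
by rewrite oner_eq0.
Qed.

Let line_inj s t : line s = line t -> s = t.
Proof.
move=> /addrI/eqP; rewrite -subr_eq0 -scalerBl scaler_eq0 !subr_eq0 => /orP[/eqP//|].
by move/eqP/esym/e01.
Qed.

Let gU0 x : g x -> ~ U x.
Proof. by have [_ _ <-] := gU; case. Qed.

Let line_ends t : t = 0 \/ t = 1 -> g (line t).
Proof.
move=> t01; have [_ _ _ _ geE] := ge.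
have : (e @` `[0, 1]) (line t).
  case: t01 => ->; [exists 0|exists 1]; rewrite /= ?in_itv/= ?lexx ?ler01//.
    by rewrite /line scale0r addr0.
  by rewrite /line scale1r addrC subrK.
by rewrite -geE => -[].
Qed.

Let gline t : g (line t) -> t = 0 \/ t = 1.
Proof.
move=> gt; have [_ _ _ epos geE] := ge.
have : (g `&` [set x | 0 <= side a u x]) (line t) by split; rewrite //= side_line0.
rewrite geE => -[s /=]; rewrite in_itv/= => /andP[s0 s1] es.
have [sE|sn0] := eqVneq s 0.
  left; apply: line_inj; rewrite -es sE /line scale0r addr0 //.
have [sE|sn1] := eqVneq s 1.
  by right; apply: line_inj; rewrite -es sE /line scale1r addrC subrK.
have := epos s; rewrite !lt_neqAle eq_sym sn0 s0 sn1 s1 => /(_ isT) /andP[].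
by rewrite es side_line0 eqxx.
Qed.

(* [line @^-1` U] is open, and closed away from [0] and [1]. *)
Let line_component (I : interval R) s t :
  (0 : R) \notin I -> (1 : R) \notin I -> s \in I -> t \in I ->
  U (line s) -> U (line t).
Proof.
move=> I0 I1 sI tI Us; have [oU _ clU] := gU.
have cI : connected [set` I].
  by apply/connected_intervalP; exact: interval_is_interval.
have E : [set` I] `&` line @^-1` U = [set` I].
  apply: cI; first by exists s.
    exists (line @^-1` U) => //; apply: open_comp => // x _.
    exact: continuous_line.
  exists (line @^-1` closure U).
    apply: preimage_closed; last exact: closed_closure.
    by move=> x _; exact: continuous_line.
  apply/seteqP; split => x [xI]; first by move=> Ux; split => //; exact: subset_closure.
  rewrite /= -(curve_bounds_closure gU) => -[//|/gline[] xE].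
    by move: xI; rewrite /= xE (negPf I0).
  by move: xI; rewrite /= xE (negPf I1).
have : [set` I] t by [].
by rewrite -E => -[].
Qed.

Let line_bounded : exists M, forall t, U (line t) -> `|t| <= M.
Proof.
have [_ [M [_ HM]] _] := gU.
have n0 : 0 < `|e 1 - e 0|.
  by rewrite normr_gt0 subr_eq0; apply/eqP => /esym/e01.
exists ((`|M| + 1 + `|e 0|) / `|e 1 - e 0|) => t Ut.
have lt : `|line t| <= `|M| + 1.
  by apply: HM Ut; rewrite (le_lt_trans (ler_norm M))// ltrDl.
have E : t *: (e 1 - e 0) = line t - e 0 by rewrite /line addrAC subrr add0r.
rewrite ler_pdivlMr// -normrZ E (le_trans (ler_normB _ _))//.
by rewrite lerD2r.
Qed.

(** The contraction moves the mirror image of its base point [x0] to [x0] inside [U], so this path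
    crosses the axis. *)
Let axis_meets : exists2 x, U x & side a u x = 0.
Proof.
have [x0 [Ux0 [H [cH HU H0 H1]]]] := cU.
pose y := reflection a u x0.
have Uy : U y by exact: sU.
pose h := side a u \o ((fun t => H t y) \o clamp 0 1).
have ch : continuous h.
  move=> t; apply: (@continuous_comp _ _ _ ((fun t => H t y) \o clamp 0 1)
    (side a u)); last exact: continuous_side.
  apply: continuous_clampE => //; apply/subspace_continuousP => {}t t01.
  have /subspace_continuousP/(_ (t, y) (conj t01 Uy)) cHt := cH.
  apply: cvg_trans cHt; move=> P /= HP.
  have cty : continuous (fun s : R => (s, y)).
    by move=> s; apply: (cvg_pair (@cvg_id _ _) (cvg_cst y)).
  have : nbhs t [set s | ([set` `[0, 1]] `*` U) (s, y) -> P (H s y)].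
    exact: (cty t _ HP).
  rewrite /= /within /=; apply: filterS => s Ps s01.
  by apply: Ps.
have [|c /andP[c0 c1] hc] := ivt_zero ler01 ch.
  rewrite /h /= !clamp_id ?lexx ?ler01// H0// H1// side_reflection//.
  rewrite oppr_le0 oppr_ge0 !andbb.
  by have [] := leP 0 (side a u x0); [left|move=> /ltW; right].
exists (H (clamp 0 1 c) y) => //.
by apply: HU => //; exact: clamp_itv.
Qed.

(** One point of [U] on the axis exists by [axis_meets]. It lies on the open chord by boundedness of
    [U], and [line_component] spreads it over the whole open chord. *)
Lemma axis_inside x : side a u x = 0 ->
  U x <-> exists2 t, 0 < t < 1 & x = line t.
Proof.
move=> x0; have [_ _ [h0 h1] _ _] := ge.
have inI t : U (line t) -> 0 < t < 1.
  move=> Ut; have [M HM] := line_bounded; have M0 := normr_ge0 M.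
  rewrite !ltNge; apply/andP; split; apply/negP => t01.
    have [t0|t0] := eqVneq t 0; first by apply: gU0 Ut; apply: line_ends; left.
    (* The ray from [t] away from the chord avoids 0 and 1, so it would lie in [U], past the bound
       [M]. *)
    have : U (line (Num.min t (- (`|M| + 1)))).
      apply: (@line_component `]-oo, t] t) => //; rewrite ?in_itv/= ?ge_min ?lexx//.
        by rewrite -ltNge lt_neqAle t0.
      by rewrite -ltNge; lra.
    move/HM; rewrite ler_norml => /andP[+ _].
    by rewrite le_min => /andP[_]; have := ler_norm M; lra.
  have [t1|t1] := eqVneq t 1; first by apply: gU0 Ut; apply: line_ends; right.
  have : U (line (Num.max t (`|M| + 1))).
    apply: (@line_component `[t, +oo[ t) => //;
      rewrite ?in_itv/= ?le_max ?lexx ?andbT//.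
      by rewrite -ltNge; lra.
    by rewrite -ltNge lt_neqAle eq_sym t1.
  move/HM; rewrite ler_norml => /andP[_].
  by rewrite ge_max => /andP[_]; have := ler_norm M; lra.
have onl y : side a u y = 0 -> exists t, y = line t.
  by move=> y0; exact: (side_line u0 h0 h1 y0 e01).
split=> [Ux|[t t01 ->]].
  by have [t xt] := onl x x0; exists t => //; apply: inI; rewrite -xt.
have [y Uy y0] := axis_meets; have [s ys] := onl y y0.
rewrite ys in Uy; apply: (@line_component `]0, 1[ s) => //;
  rewrite ?in_itv/= ?ltxx ?andbF//.
exact: inI.
Qed.

Let Up : set (plane R) := U `&` [set x | 0 < side a u x].

Let open_pos : open [set x : plane R | 0 < side a u x].
Proof.
apply: (@open_comp _ _ (side a u) [set s | 0 < s]); last exact: open_gt.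
by move=> x _; exact: continuous_side.
Qed.

Let closed_nneg : closed [set x : plane R | 0 <= side a u x].
Proof.
apply: (@preimage_closed _ _ (side a u) [set s | 0 <= s]); last exact: closed_ge.
by move=> x _; exact: continuous_side.
Qed.

(** Moving [t] slightly towards 1/2 gives a parameter in (0, 1) with a nearby value. *)
Let closure_ends (h : R -> plane R) (C : set (plane R)) t :
  closed C -> continuous h -> (forall s, 0 < s < 1 -> C (h s)) ->
  0 <= t <= 1 -> C (h t).
Proof.
move=> /closure_id clC ch hC /andP[t0 t1]; rewrite clC => B hB.
have /nbhs_ballP[r /= r0 Hr] : nbhs t (h @^-1` B) by exact: ch hB.
have [d /andP[d0 d1] dr] : exists2 d, 0 < d < 1 & d < r.
  have m0 : 0 < Num.min r 1 by rewrite lt_min r0 ltr01.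
  have m1 : Num.min r 1 <= 1 by rewrite ge_min lexx orbT.
  have mr : Num.min r 1 <= r by rewrite ge_min lexx.
  by exists (Num.min r 1 / 2); [apply/andP; lra|lra].
exists (h (t + d * (1 / 2 - t))); split.
  by apply: hC; apply/andP; split; nra.
apply: Hr; rewrite -ball_normE /= opprD addNKr normrN normrM (gtr0_norm d0).
have : `|1 / 2 - t| <= 1 by rewrite ler_norml; apply/andP; lra.
by nra.
Qed.

Let axis_closure x : U x -> side a u x = 0 -> closure Up x.
Proof.
move=> Ux x0 B Bx; have [oU _ _] := gU.
have nUB : nbhs x (U `&` B).
  by apply: filterI => //; exact: open_nbhs_nbhs.
have [t t0 [[Ut Bt] _]] := nbhs_normal u nUB.
exists (x + t *: normal u); split => //; split => //=.
by rewrite side_shift// x0 add0r.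
Qed.

(** A frontier point of the half lies in [g], hence on the arc, or in [U], hence on the axis and the
    chord. Conversely the open arc and the open chord are limits of [Up], and [closure_ends] adds
    their end-points. *)
Let Up_closure : closure Up `\` Up = e @` `[0, 1] `|` line @` `[0, 1].
Proof.
have [ce ei [h0 h1] epos geE] := ge; have [oU _ clU] := gU.
apply/seteqP; split => x.
  move=> [cUpx nUpx].
  have x0 : 0 <= side a u x.
    have /closure_id E := closed_nneg.
    by move: cUpx; have : closure Up `<=` [set x | 0 <= side a u x];
      [rewrite E; apply: closureS => y [_ /= /ltW]|apply].
  have : closure U x by apply: closureS cUpx; exact: subIsetl.
  rewrite -(curve_bounds_closure gU) => -[Ux|gx]; last by left; rewrite -geE.
  have sx : side a u x = 0.
    by apply/eqP; rewrite eq_le x0 andbT leNgt; apply/negP => x0'; apply: nUpx.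
  have [t /andP[t0 t1] ->] := (axis_inside sx).1 Ux.
  by right; exists t => //=; rewrite in_itv/= !ltW.
move=> [[t /=]|[t /=]]; rewrite in_itv/= => t01 <-; split.
- apply: (closure_ends (h := e)) => // [|s s01]; first exact: closed_closure.
  have [ges _] : (g `&` [set x | 0 <= side a u x]) (e s).
    by rewrite geE; exists s => //=; rewrite in_itv/=; case/andP: s01 => *; rewrite !ltW.
  move=> B Be.
  have cl : closure U (e s) by rewrite -(curve_bounds_closure gU); right.
  have [y [Uy [By py]]] := cl (B `&` [set x | 0 < side a u x])
    (filterI Be (open_nbhs_nbhs (conj open_pos (epos s s01)))).
  by exists y; split.
- have [get _] : (g `&` [set x | 0 <= side a u x]) (e t).
    by rewrite geE; exists t => //=; rewrite in_itv.
  by move=> [/(gU0 get)].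
- apply: (closure_ends (h := line)) => // [||s s01].
  + exact: closed_closure.
  + exact: continuous_line.
  + apply: axis_closure; last exact: side_line0.
    by apply/(axis_inside (side_line0 s)); exists s.
- by move=> [_ /=]; rewrite side_line0 ltxx.
Qed.

(** The identity where the side is nonnegative, the reflection where it is negative. *)
Let fold x : plane R := x + (`|side a u x| - side a u x) *: normal u.

(** The push is proportional to the time: none at time 0, where points of [Up] must stay put, and a
    positive one afterwards, which makes the side positive. *)
Let contractible_Up : contractible Up.
Proof.
have [oU bU _] := gU.
have nU : ~` U !=set0.
  have [t tU] : exists t, ~ U (line t).
    have [M HM] := line_bounded; exists (`|M| + 1) => /HM.
    by have := ler_norm M; have := ler_norm (`|M| + 1); lra.
  by exists (line t).
have [d [cd dU Ud]] := interior_radius oU nU.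
have [x0 [Ux0 [H [cH HU H0 H1]]]] := cU.
have foldU x : U x -> U (fold x) /\ 0 <= side a u (fold x).
  move=> Ux; rewrite /fold side_shift// addrCA subrr addr0; split => //.
  have [p|n] := leP 0 (side a u x).
    by rewrite ger0_norm// subrr scale0r addr0.
  have := sU Ux; rewrite reflectionE// -scaleNr.
  by rewrite (_ : - _ = `|side a u x| - side a u x)// ltr0_norm//; ring.
have cfold : continuous fold.
  move=> x; apply: cvgD; first exact: cvg_id.
  apply: cvgZr_tmp; apply: cvgB; last exact: continuous_side.
  apply: (@continuous_comp _ _ _ (side a u) (@Num.norm R R)).
    exact: continuous_side.
  exact: norm_continuous.
(* Larger than the norm of [normal u], so that a push by at most [d x / n1] moves [x] by less than
   [d x] and stays in [U]. *)
pose n1 := `|normal u| + 1.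
have n0 : 0 < n1 by rewrite ltr_wpDl.
pose push (t : R) x := x + (t * (d x / n1)) *: normal u.
have pushU t x : 0 <= t <= 1 -> U x -> U (push t x).
  move=> /andP[t0 t1] Ux; apply: (Ud x); have d0 := dU x Ux.
  rewrite /push opprD addNKr normrN normrZ ger0_norm; last first.
    by rewrite mulr_ge0// divr_ge0// ltW.
  have dn : 0 < d x / n1 by rewrite divr_gt0.
  apply: (@le_lt_trans _ _ (d x / n1 * `|normal u|)).
    by rewrite ler_wpM2r// ler_piMl// ltW.
  have : d x / n1 * n1 = d x by rewrite divfK// gt_eqF.
  by rewrite /n1 mulrDr mulr1 -/n1; lra.
have pushUp t x : 0 < t <= 1 -> U x -> 0 <= side a u x -> Up (push t x).
  move=> /andP[t0 t1] Ux sx; split; first by apply: pushU => //; rewrite ltW.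
  by rewrite /push /= side_shift// ltr_wpDl// mulr_gt0// divr_gt0// dU.
exists (push 1 (fold x0)); split.
  by have [? ?] := foldU _ Ux0; apply: pushUp; rewrite ?ltr01 ?lexx.
exists (fun t x => push t (fold (H t x))); split.
- have cHUp : {within `[0, 1] `*` Up, continuous (fun z : R * (R * R) => H z.1 z.2)}.
    by apply: continuous_subspaceW cH => z [z1 [Uz _]].
  have cG : continuous (fun z : R * plane R => push z.1 (fold z.2)).
    have cf2 : continuous (fun z : R * plane R => fold z.2).
      move=> z; apply: (@continuous_comp _ _ _ (fun z : R * plane R => z.2) fold).
        exact: cvg_snd.
      exact: cfold.
    move=> z; apply: cvgD; first exact: cf2.
    apply: cvgZr_tmp; apply: cvgM; first exact: cvg_fst.
    apply: cvgMr_tmp; apply: (@continuous_comp _ _ _ (fun z => fold z.2) d).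
      exact: cf2.
    exact: cd.
  apply/subspace_continuousP => z zD.
  have /subspace_continuousP/(_ z zD) cHz := cHUp.
  apply: (@cvg_comp _ _ _ (fun z => (z.1, H z.1 z.2))
    (fun z : R * plane R => push z.1 (fold z.2)) _ _ _ _ (cG (z.1, H z.1 z.2))).
  have c1 : w.1 @[w --> within (`[0, 1] `*` Up) (nbhs z)] --> z.1.
    by apply: cvg_within_filter; exact: cvg_fst.
  exact: (cvg_pair c1 cHz).
- move=> t x t01 [Ux /= sx]; have [t0|tn0] := eqVneq t 0.
    rewrite t0 H0// /push mul0r scale0r addr0 /fold ger0_norm ?(ltW sx)//.
    by rewrite subrr scale0r addr0; split.
  have [? ?] := foldU _ (HU t x t01 Ux); apply: pushUp => //.
  by rewrite lt_neqAle eq_sym tn0; case/andP: t01 => -> ->.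
- move=> x [Ux /= sx]; rewrite H0// /push mul0r scale0r addr0 /fold.
  by rewrite ger0_norm ?(ltW sx)// subrr scale0r addr0.
- by move=> x [Ux _]; rewrite H1.
Qed.

(** The loop runs along [e] and back along the chord. These meet only at their ends, because [e] is
    strictly off the axis in between. *)
Let half_boundary_loop : simple_closed_curve (e @` `[0, 1] `|` line @` `[0, 1]).
Proof.
have [ce ei [h0 h1] epos geE] := ge.
pose f t := if t <= 1 / 2 then e (2 * t) else line (2 - 2 * t).
have mid : f (1 / 2) = e 1 by rewrite /f lexx; congr e; lra.
have l0 : line 0 = e 0 by rewrite /line scale0r addr0.
have l1 : line 1 = e 1 by rewrite /line scale1r addrC subrK.
have eaxis t : 0 <= t <= 1 -> side a u (e t) = 0 -> t = 0 \/ t = 1.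
  move=> /andP[t0 t1] st.
  have [|tn0] := eqVneq t 0; first by left.
  have [|tn1] := eqVneq t 1; first by right.
  by have := epos t; rewrite !lt_neqAle eq_sym tn0 tn1 t0 t1 st eqxx => /(_ isT).
have mixed (s t : R) : 0 <= s <= 1 / 2 -> 1 / 2 < t < 1 ->
    e (2 * s) <> line (2 - 2 * t).
  move=> /andP[s0 s1] /andP[t0 t1] st.
  have := eaxis (2 * s); rewrite st side_line0 => /(_ _ erefl) [||].
  - by apply/andP; lra.
  - move=> sE; move: st; rewrite sE -l0 => /line_inj; lra.
  - move=> sE; move: st; rewrite sE -l1 => /line_inj; lra.
apply/loop_paramP; exists f; split.
- apply: (@continuous_paste R (plane R) (fun t => e (2 * t))
    (fun t => line (2 - 2 * t)) (1 / 2)).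
  + move=> t; apply: (@continuous_comp _ _ _ (fun t : R => 2 * t) e); last exact: ce.
    by apply: cvgMl_tmp; exact: cvg_id.
  + move=> t; apply: (@continuous_comp _ _ _ (fun t : R => 2 - 2 * t) line).
      by apply: cvgB; [exact: cvg_cst|apply: cvgMl_tmp; exact: cvg_id].
    exact: continuous_line.
  + by rewrite (_ : 2 - _ = 1) ?l1; [congr e; lra|lra].
- rewrite /f (_ : 0 <= 1 / 2) ?mulr0; last by lra.
  by rewrite (_ : (1 <= 1 / 2) = false) ?mulr1 ?subrr ?l0//; apply/negP; lra.
- move=> s t /andP[s0 s1] /andP[t0 t1]; rewrite /f.
  case: (leP s) => hs; case: (leP t) => ht.
  + move=> est; have : 2 * s = 2 * t by apply: ei est; apply/andP; lra.
    lra.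
  + by move/mixed => H; exfalso; apply: H; apply/andP; lra.
  + by move/esym/mixed => H; exfalso; apply: H; apply/andP; lra.
  + by move/line_inj; lra.
- apply/seteqP; split => x.
    move=> [t /=]; rewrite in_itv/= => /andP[t0 t1] <-; rewrite /f.
    case: leP => ht.
      by left; exists (2 * t) => //=; rewrite in_itv/=; apply/andP; lra.
    by right; exists (2 - 2 * t) => //=; rewrite in_itv/=; apply/andP; lra.
  move=> [[t /=]|[t /=]]; rewrite in_itv/= => /andP[t0 t1] <-.
    exists (t / 2); first by rewrite /= in_itv/=; apply/andP; lra.
    by rewrite /f (_ : t / 2 <= 1 / 2); [congr e; lra|lra].
  have [->|tn1] := eqVneq t 1.
    by exists (1 / 2); rewrite ?mid ?l1//= in_itv/=; apply/andP; lra.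
  have {}t1 : t < 1 by rewrite lt_neqAle tn1.
  exists (1 - t / 2); first by rewrite /= in_itv/=; apply/andP; lra.
  rewrite /f (_ : (1 - t / 2 <= 1 / 2) = false); first by congr line; lra.
  by apply/negP; lra.
Qed.

Lemma half_tile :
  tile_with_boundary ((U `|` g) `&` [set x | 0 <= side a u x])
    (e @` `[0, 1] `|` line @` `[0, 1]).
Proof.
have [_ _ [h0 h1] _ geE] := ge; have [oU bU _] := gU.
split; first exact: half_boundary_loop.
exists Up; split.
- split; [exact: openI| |exact: Up_closure].
  have [M [Mr HM]] := bU; exists M; split => // N MN x [Ux _].
  exact: (HM N MN x Ux).
- exact: contractible_Up.
- apply/seteqP; split => x.
    move=> [[Ux|gx] sx]; last by right; left; rewrite -geE.
    (* A point of [U] on the axis goes to the boundary chord, not to the open half. *)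
    have [s0|sn0] := eqVneq (side a u x) 0; last first.
      by left; split; rewrite //= lt_neqAle eq_sym sn0 sx.
    right; right; have [t /andP[t0 t1] ->] := (axis_inside s0).1 Ux.
    by exists t => //=; rewrite in_itv/= !ltW.
  move=> [[Ux /= /ltW sx]|[|[t /=]]].
  + by split => //; left.
  + by rewrite -geE => -[gx sx]; split => //; right.
  + rewrite in_itv/= => /andP[t0 t1] <-; split; last by rewrite /= side_line0.
    have [t0'|tn0] := eqVneq t 0; first by right; apply: line_ends; left.
    have [t1'|tn1] := eqVneq t 1; first by right; apply: line_ends; right.
    left; apply/(axis_inside (side_line0 t)); exists t => //.
    by rewrite !lt_neqAle eq_sym tn0 tn1 t0 t1.
Qed.

End HalfTile.

(** * Cutting the tile along its axis *)

Lemma interior_reflection (R : realType) (a u : plane R) (T : set (plane R)) :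
  u != 0 -> (forall x, T x -> T (reflection a u x)) ->
  forall x, interior T x -> interior T (reflection a u x).
Proof.
move=> u0 sT x Tx.
have cr : {for reflection a u x, continuous (reflection a u)}.
  exact: continuous_reflection.
have : nbhs (reflection a u x) (reflection a u @^-1` T).
  by apply: cr; rewrite reflectionK.
by apply: filterS => y /= /sT; rewrite reflectionK.
Qed.

(* A point of the axis is not interior to a half, so it lies on any boundary
   of that half. *)
Lemma axis_in_boundary (R : realType) (a u x : plane R)
    (T g : set (plane R)) :
  u != 0 -> (forall y, T y -> 0 <= side a u y) -> tile_with_boundary T g ->
  T x -> side a u x = 0 -> g x.
Proof.
move=> u0 Ts [_ [U [[oU _ _] _ TE]]] Tx x0.
move: (Tx); rewrite TE => -[Ux|//]; exfalso.
have [t t0 [_ Ut]] := nbhs_normal u (open_nbhs_nbhs (conj oU Ux)).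
have := Ts (x - t *: normal u); rewrite TE -scaleNr side_shift// x0.
by rewrite scaleNr => /(_ (or_introl Ut)); lra.
Qed.

Theorem proposition4p1 (R : realType) (n : nat) (T : set (plane R))
    (n_ge3 : (3 <= n)%N) (n_odd : odd n)
    (T_wedge : n_wedge n T) (T_sym : has_symmetry_line T) :
  exists T1 T2 : set (plane R),
    [/\ T1 <> T2, congruent T1 T2 & tiled_by T [set T1; T2]%classic].
Proof.
have [[[g [gC [U [gU cU TE]]]] _] _] := T_wedge.
have [a [u [u0 TS]]] := T_sym.
have sT x : T x -> T (reflection a u x) by move=> Tx; rewrite -TS; exists x.
have Une : U !=set0 by have [x0 [Ux0 _]] := cU; exists x0.
have gint := curve_boundary gC gU Une; rewrite -TE in gint.
have [oU bU clU] := gU.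
(* Recovering [U] from [T] alone lets the symmetry of [T] pass to [U], and then to [g]. *)
have UE : interior T = U.
  apply/seteqP; split => x.
    move=> iTx; have := interior_subset iTx; rewrite {1}TE => -[//|gx].
    by have : (interior T `&` g) x by []; rewrite gint.
  by rewrite -{1}((interior_id U).1 oU); apply: interiorS; rewrite TE; exact: subsetUl.
have sU x : U x -> U (reflection a u x).
  by rewrite -UE; exact: interior_reflection.
have sg x : g x -> g (reflection a u x).
  move=> gx; have : T (reflection a u x) by apply: sT; rewrite TE; right.
  rewrite TE => -[/sU|//]; rewrite reflectionK// => Ux.
  by move: gx; rewrite -clU => -[_ /(_ Ux)].
have [e ge] := symmetric_loop_half_arc u0 gC sg.
(* Reversing [u] keeps the axis and exchanges its sides, so the other half is obtained from the same
   lemmas. *)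
have Nu0 : - u != 0 by rewrite oppr_eq0.
have sUN x : U x -> U (reflection a (- u) x) by rewrite reflectionN//; exact: sU.
have sgN x : g x -> g (reflection a (- u) x) by rewrite reflectionN//; exact: sg.
have [e' ge'] := symmetric_loop_half_arc Nu0 gC sgN.
pose T1 := T `&` [set x | 0 <= side a u x].
pose T2 := T `&` [set x | 0 <= side a (- u) x].
have t1 : tile T1 by eexists; rewrite /T1 TE; exact: (half_tile u0 gU cU sU ge).
have t2 : tile T2 by eexists; rewrite /T2 TE; exact: (half_tile Nu0 gU cU sUN ge').
have both x : T1 x -> T2 x -> side a u x = 0.
  by move=> [_ /= h1] [_ /=]; rewrite sideN// => h2; lra.
have meet g1 g2 : tile_with_boundary T1 g1 -> tile_with_boundary T2 g2 ->
    T1 `&` T2 `<=` g1 `&` g2.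
  move=> tg1 tg2 x [T1x T2x]; have x0 := both x T1x T2x; split.
    by apply: (@axis_in_boundary R a u x _ _ u0 _ tg1 T1x x0) => y [].
  apply: (@axis_in_boundary R a (- u) x _ _ Nu0 _ tg2 T2x) => [y []//|].
  by rewrite sideN// x0 oppr0.
exists T1, T2; split.
(* Equal halves would lie on the axis, but the middle of the arc does not. *)
- move=> T12; have [_ _ _ epos geE] := ge.
  have : T1 (e (1 / 2)).
    have : (g `&` [set x | 0 <= side a u x]) (e (1 / 2)).
      by rewrite geE; exists (1 / 2) => //=; rewrite in_itv/=; apply/andP; lra.
    by move=> [gx sx]; split => //; rewrite TE; right.
  move=> T1x; have := both _ T1x; rewrite -T12 => /(_ T1x).
  by have := epos (1 / 2); move=> /(_ ltac:(apply/andP; lra)); lra.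
- exists (reflection a u); first exact: reflection_isometry.
  apply/seteqP; split => x.
    move=> [y [Ty /= sy] <-]; split; first exact: sT.
    by rewrite /= sideN// side_reflection// opprK.
  move=> [Tx /= sx]; exists (reflection a u x); last by rewrite reflectionK.
  by split; [exact: sT|rewrite /= side_reflection// -sideN].
- split.
  + have TcU : T = closure U by rewrite TE; exact: curve_bounds_closure.
    split; first by rewrite TcU; exact: closed_closure.
    have [M HM] := closure_bounded bU; exists M; split; first exact: num_real.
    move=> N MN x.
    by rewrite TcU => /HM /le_trans; apply; exact: ltW.
  + by move=> A [->|->].
  + apply/seteqP; split => x.
      by move=> [A [->|->]] [].
    move=> Tx; have [s0|s0] := leP 0 (side a u x).
      by exists T1; [left|split].
    exists T2; first by right.
    by split; rewrite //= sideN// oppr_ge0 ltW.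
  + move=> A B [->|->] [->|->] AB g1 g2 tg1 tg2 //; first exact: meet.
    by rewrite (setIC T2) (setIC g1); exact: meet.
Qed.
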